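(* There exist a prime number $p>0$ and a complete local Noetherian normal domain $R$ of characteristic $p$ such that the perfection $R_{\mathrm{perf}}$ is a GCD domain and is not coherent.
   Context: For a ring $R$ of prime characteristic $p>0$, the perfection (perfect closure) of $R$ is $R_{\mathrm{perf}}=\varinjlim\left(R\xrightarrow{F}R\xrightarrow{F}\cdots\right)$, where $F:R\to R$ is the Frobenius map $r\mapsto r^p$. A commutative ring is coherent if all of its finitely generated ideals are finitely presented. A domain $A$ (not necessarily Noetherian) is a GCD domain if for all $r,s\in A$ the ideal $rA\cap sA$ is principal (equivalently, the ideal $(r:_A s)=\{x\in A\mid xs\in rA\}$ is principal for all $r,s \in A$ with $s\neq 0$). *)

(* Defs.v *)
From HB Require Import structures.
From mathcomp Require Import all_boot all_order all_algebra generic_quotient.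
From mathcomp Require Import boolp classical_sets.
From mathcomp Require Import zify.

Set Implicit Arguments.
Unset Strict Implicit.
Unset Printing Implicit Defensive.

Import GRing.Theory.
Local Open Scope ring_scope.
Local Open Scope classical_set_scope.
Local Open Scope quotient_scope.

(* The colimit in commutative rings of R --phi--> R --phi--> R --phi--> ...
   A pair (n, x) stands for the element x of the n-th copy of R; two pairs are
   identified when their images in some common later copy coincide. *)
Section IterColim.
Context (R : comNzRingType) (phi : {rmorphism R -> R}).
Implicit Types (x y z : nat * R) (a b : R).

Definition colim_eqv x y : bool :=
  `[< exists k, iter (y.1 + k) phi x.2 = iter (x.1 + k) phi y.2 >].

Lemma colim_eqv_refl : reflexive colim_eqv.
Proof. by move=> x; apply/asboolP; exists 0%N. Qed.

Lemma colim_eqv_sym : symmetric colim_eqv.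
Proof. by move=> x y; apply/asboolP/asboolP => -[k e]; exists k. Qed.

Lemma colim_eqv_trans : transitive colim_eqv.
Proof.
move=> y x z /asboolP[k exy] /asboolP[j eyz]; apply/asboolP.
exists (y.1 + k + j)%N.
have -> : (z.1 + (y.1 + k + j) = (z.1 + j) + (y.1 + k))%N by lia.
have -> : (x.1 + (y.1 + k + j) = (x.1 + k) + (y.1 + j))%N by lia.
rewrite iterD exy -iterD addnC iterD eyz -iterD; congr (iter _ _ _); lia.
Qed.

Canonical colim_equiv :=
  EquivRel colim_eqv colim_eqv_refl colim_eqv_sym colim_eqv_trans.

Definition iter_colim := {eq_quot colim_equiv}.
HB.instance Definition _ := Choice.on iter_colim.
HB.instance Definition _ := EqQuotient.on iter_colim.

Definition to_colim (n : nat) (a : R) : iter_colim := \pi_iter_colim (n, a).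

Lemma colimP (u : iter_colim) : exists n a, u = to_colim n a.
Proof. by exists (repr u).1, (repr u).2; rewrite /to_colim -surjective_pairing reprK. Qed.

Lemma to_colim_eq m n a b :
  to_colim m a = to_colim n b <->
  exists k, iter (n + k) phi a = iter (m + k) phi b.
Proof.
split=> [/eqmodP/asboolP //|e]; apply/eqmodP; exact/asboolP.
Qed.

Lemma to_colim_shift k n a : to_colim (n + k) (iter k phi a) = to_colim n a.
Proof.
by apply/to_colim_eq; exists 0%N; rewrite !addn0 iterD.
Qed.

Lemma iterphi0 k : iter k phi 0 = 0.
Proof. by elim: k => //= k ->; rewrite rmorph0. Qed.
Lemma iterphi1 k : iter k phi 1 = 1.
Proof. by elim: k => //= k ->; rewrite rmorph1. Qed.
Lemma iterphiN k : {morph iter k phi : a / - a}.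
Proof. by move=> a; elim: k => //= k ->; rewrite rmorphN. Qed.
Lemma iterphiD k : {morph iter k phi : a b / a + b}.
Proof. by move=> a b; elim: k => //= k ->; rewrite rmorphD. Qed.
Lemma iterphiM k : {morph iter k phi : a b / a * b}.
Proof. by move=> a b; elim: k => //= k ->; rewrite rmorphM. Qed.

(* Operations move both arguments to the copy of index x.1 + y.1. *)
Definition colim_add (u v : iter_colim) : iter_colim :=
  let x := repr u in let y := repr v in
  to_colim (x.1 + y.1) (iter y.1 phi x.2 + iter x.1 phi y.2).
Definition colim_mul (u v : iter_colim) : iter_colim :=
  let x := repr u in let y := repr v in
  to_colim (x.1 + y.1) (iter y.1 phi x.2 * iter x.1 phi y.2).
Definition colim_opp (u : iter_colim) : iter_colim :=
  let x := repr u in to_colim x.1 (- x.2).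

Lemma colim_level3 (u v w : iter_colim) : exists n a b c,
  [/\ u = to_colim n a, v = to_colim n b & w = to_colim n c].
Proof.
have [i [a ->]] := colimP u; have [j [b ->]] := colimP v.
have [k [c ->]] := colimP w.
exists (i + (j + k))%N, (iter (j + k) phi a), (iter (i + k) phi b),
  (iter (i + j) phi c).
split.
- by rewrite to_colim_shift.
- by rewrite addnCA to_colim_shift.
- rewrite (_ : i + (j + k) = k + (i + j))%N ?to_colim_shift //; lia.
Qed.

Lemma repr_colim n a : exists k,
  iter ((repr (to_colim n a)).1 + k) phi a = iter (n + k) phi (repr (to_colim n a)).2.
Proof.
apply/to_colim_eq.
by rewrite [RHS]/to_colim -surjective_pairing reprK.
Qed.

Lemma colim_binE (op : R -> R -> R) n a b :
    (forall k, {morph iter k phi : a b / op a b}) ->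
  let x := repr (to_colim n a) in let y := repr (to_colim n b) in
  to_colim (x.1 + y.1) (op (iter y.1 phi x.2) (iter x.1 phi y.2)) =
  to_colim n (op a b).
Proof.
move=> opM; have := repr_colim n a; have := repr_colim n b.
move: (repr (to_colim n a)) (repr (to_colim n b)) => [i a'] [j b'] /=.
move=> [l eb] [k ea]; apply/to_colim_eq; exists (k + l)%N; rewrite !opM.
congr op.
  rewrite -iterD [RHS](_ : _ = iter ((j + l) + (i + k)) phi a); last first.
    by congr (iter _ _ _); lia.
  by rewrite [RHS]iterD ea -iterD; congr (iter _ _ _); lia.
rewrite -iterD [RHS](_ : _ = iter ((i + k) + (j + l)) phi b); last first.
  by congr (iter _ _ _); lia.
by rewrite [RHS]iterD eb -iterD; congr (iter _ _ _); lia.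
Qed.

Lemma colim_addE n a b :
  colim_add (to_colim n a) (to_colim n b) = to_colim n (a + b).
Proof. exact: (@colim_binE (fun a b => a + b) n a b iterphiD). Qed.

Lemma colim_mulE n a b :
  colim_mul (to_colim n a) (to_colim n b) = to_colim n (a * b).
Proof. exact: (@colim_binE (fun a b => a * b) n a b iterphiM). Qed.

Lemma colim_oppE n a : colim_opp (to_colim n a) = to_colim n (- a).
Proof.
rewrite /colim_opp; have := repr_colim n a.
case: (repr _) => [i a'] /= [k ea]; apply/to_colim_eq.
by exists k; rewrite !iterphiN ea.
Qed.

Lemma to_colim0 n : to_colim n 0 = to_colim 0 0.
Proof. by rewrite -(to_colim_shift n 0) iterphi0. Qed.
Lemma to_colim1 n : to_colim n 1 = to_colim 0 1.
Proof. by rewrite -(to_colim_shift n 0) iterphi1. Qed.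

Lemma colim_addA : associative colim_add.
Proof.
move=> u v w; have [n [a [b [c [-> -> ->]]]]] := colim_level3 u v w.
by rewrite !colim_addE addrA.
Qed.
Lemma colim_addC : commutative colim_add.
Proof.
move=> u v; have [n [a [b [_ [-> -> _]]]]] := colim_level3 u v v.
by rewrite !colim_addE addrC.
Qed.
Lemma colim_add0 : left_id (to_colim 0 0) colim_add.
Proof. by move=> u; have [n [a ->]] := colimP u; rewrite -(to_colim0 n) colim_addE add0r. Qed.
Lemma colim_addN : left_inverse (to_colim 0 0) colim_opp colim_add.
Proof.
by move=> u; have [n [a ->]] := colimP u; rewrite -(to_colim0 n) colim_oppE colim_addE addNr.
Qed.
HB.instance Definition _ :=
  GRing.isZmodule.Build iter_colim colim_addA colim_addC colim_add0 colim_addN.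

Lemma colim_mulA : associative colim_mul.
Proof.
move=> u v w; have [n [a [b [c [-> -> ->]]]]] := colim_level3 u v w.
by rewrite !colim_mulE mulrA.
Qed.
Lemma colim_mulC : commutative colim_mul.
Proof.
move=> u v; have [n [a [b [_ [-> -> _]]]]] := colim_level3 u v v.
by rewrite !colim_mulE mulrC.
Qed.
Lemma colim_mul1 : left_id (to_colim 0 1) colim_mul.
Proof. by move=> u; have [n [a ->]] := colimP u; rewrite -(to_colim1 n) colim_mulE mul1r. Qed.
Lemma colim_mulD : left_distributive colim_mul colim_add.
Proof.
move=> u v w; have [n [a [b [c [-> -> ->]]]]] := colim_level3 u v w.
by rewrite !(colim_mulE, colim_addE) mulrDl.
Qed.
Lemma colim_1neq0 : to_colim 0 1 != to_colim 0 0.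
Proof.
apply/eqP => /to_colim_eq[k]; rewrite iterphi0 iterphi1.
by move/eqP; rewrite oner_eq0.
Qed.
HB.instance Definition _ := GRing.Zmodule_isComNzRing.Build iter_colim
  colim_mulA colim_mulC colim_mul1 colim_mulD colim_1neq0.

Lemma to_colim_zmod n : zmod_morphism (to_colim n).
Proof. by move=> a b; rewrite -colim_addE -colim_oppE. Qed.
Lemma to_colim_monoid n : monoid_morphism (to_colim n).
Proof. by split=> [|a b]; [exact: to_colim1 | rewrite -colim_mulE]. Qed.
HB.instance Definition _ n :=
  GRing.isZmodMorphism.Build R iter_colim (to_colim n) (to_colim_zmod n).
HB.instance Definition _ n :=
  GRing.isMonoidMorphism.Build R iter_colim (to_colim n) (to_colim_monoid n).

Lemma to_colim_phi n a : to_colim n.+1 (phi a) = to_colim n a.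
Proof. by rewrite -addn1 (to_colim_shift 1). Qed.

(* The universal property, confirming that iter_colim is the colimit. *)
Lemma iter_colim_univ (S : comNzRingType) (f : nat -> {rmorphism R -> S}) :
  (forall n a, f n.+1 (phi a) = f n a) ->
  exists2 g : {rmorphism iter_colim -> S},
    (forall n a, g (to_colim n a) = f n a) &
    forall h : {rmorphism iter_colim -> S},
      (forall n a, h (to_colim n a) = f n a) -> g =1 h.
Proof.
move=> fphi.
have fsh k n a : f (n + k)%N (iter k phi a) = f n a.
  by elim: k => [|k IH]; rewrite ?addn0 // addnS /= fphi.
pose g (u : iter_colim) := f (repr u).1 (repr u).2.
have gE n a : g (to_colim n a) = f n a.
  have [k] := repr_colim n a; rewrite /g; case: (repr _) => [i b] /= e.
  by rewrite -(fsh (n + k)%N) -e addnCA fsh.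
have gZ : zmod_morphism g.
  move=> u v; have [n [a [b [_ [-> -> _]]]]] := colim_level3 u v v.
  by rewrite -raddfB !gE raddfB.
have gM : monoid_morphism g.
  split=> [|u v]; first by rewrite -(rmorph1 (to_colim 0)) gE rmorph1.
  have [n [a [b [_ [-> -> _]]]]] := colim_level3 u v v.
  by rewrite -rmorphM !gE rmorphM.
pose gAdd := GRing.isZmodMorphism.Build iter_colim S g gZ.
pose gMul := GRing.isMonoidMorphism.Build iter_colim S g gM.
pose gR : {rmorphism iter_colim -> S} := HB.pack g gAdd gMul.
exists gR => [n a|h hE u]; first exact: gE.
by have [n [a ->]] := colimP u; rewrite hE; exact: gE.
Qed.

End IterColim.

(* R_perf, with respect to the Frobenius map pFrobenius_aut hp : x |-> x ^+ p *)
Definition perfection (R : comNzRingType) (p : nat) (hp : p \in [pchar R]) :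
  comNzRingType := iter_colim (pFrobenius_aut hp).

Section Ideals.
Context (A : comNzRingType).
Implicit Types I J : set A.

Definition is_ideal I : Prop :=
  [/\ I 0, forall x y, I x -> I y -> I (x + y) & forall a x, I x -> I (a * x)].

(* the ideal generated by the entries of g *)
Definition span n (g : 'cV[A]_n) : set A :=
  [set x | exists v : 'rV[A]_n, x = (v *m g) 0 0].

Definition principal_ideal I : Prop := exists t, I = range ( *%R t).

Definition fin_generated I : Prop := exists n (g : 'cV[A]_n), I = span g.

(* There is an exact sequence A^m --K--> A^n --g--> I --> 0. *)
Definition fin_presented I : Prop :=
  exists n (g : 'cV[A]_n), I = span g /\
  exists m (K : 'M[A]_(m, n)),
    forall v : 'rV[A]_n, v *m g = 0 <-> exists w : 'rV[A]_m, v = w *m K.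

Definition noetherian : Prop := forall I, is_ideal I -> fin_generated I.

Definition coherent : Prop :=
  forall I, is_ideal I -> fin_generated I -> fin_presented I.

Definition gcd_domain : Prop :=
  GRing.integral_domain_axiom A /\
  forall r s : A, principal_ideal (range ( *%R r) `&` range ( *%R s)).

Definition ideal_mul I J : set A :=
  [set x | exists s : seq (A * A),
     (forall ab, ab \in s -> I ab.1 /\ J ab.2) /\
     x = \sum_(ab <- s) ab.1 * ab.2].

Definition ideal_exp I (n : nat) : set A := iter n (ideal_mul I) setT.

(* The canonical map A -> lim_n A / I^n is injective and surjective; an element
   of the limit is given by representatives u n of its components. *)
Definition adically_complete I : Prop :=
  (forall x, (forall n, ideal_exp I n x) -> x = 0) /\
  (forall u : nat -> A,
     (forall n, ideal_exp I n (u n.+1 - u n)) ->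
     exists x, forall n, ideal_exp I n (x - u n)).

Definition maximal_ideal (m : set A) : Prop :=
  [/\ is_ideal m, ~ m 1 &
      forall I, is_ideal I -> m `<=` I -> ~ I 1 -> I = m].

Definition complete_local : Prop :=
  exists m, [/\ maximal_ideal m, forall m', maximal_ideal m' -> m' = m &
                adically_complete m].

End Ideals.

(* integrally closed in the fraction field *)
Definition normal_domain (R : idomainType) : Prop :=
  forall z : {fraction R}, integralOver (@tofrac R) z -> exists r, z = tofrac r.

(* Main.v *)
Require Import Defs.
From HB Require Import structures.
From mathcomp Require Import all_boot all_order all_algebra.
From mathcomp Require Import boolp classical_sets.
From mathcomp Require Import zify ring.

Set Implicit Arguments.
Unset Strict Implicit.
Unset Printing Implicit Defensive.

Import GRing.Theory.
Local Open Scope ring_scope.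
Local Open Scope classical_set_scope.

Local Notation span := Defs.span.

(** The ring is [R = F_2[[s, t]][u] / (u^2 + s t u + s^3 + t^3)].  It is the
    ring of invariants of the involution [sigma : x |-> x + t, y |-> y + s] of
    the regular local ring [S = F_2[[x, y]]], presented as the extension of
    [A = F_2[[s, t]]] by [x^2 = t x + s] and [y^2 = s y + t], with
    [u = s x + t y].  This is one of the wild [Z/2]-quotient singularities of
    Artin: the involution is free outside the closed point.

    The perfection of [R] is a GCD domain because the group has order [2 = p].
    For [a] and [b] in [R], let [d] be their greatest common divisor in [S].
    It is invariant up to a unit, so the norm [d * sigma d], which is in [R],
    is [d ^ 2] up to a unit.  Hence [a ^ 2] and [b ^ 2] are multiples, by
    coprime elements of [R], of one element of [R] ([invariants_square_gcd]);
    in the perfection the exponent [2] is harmless ([perfection_gcd]).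

    The perfection of [R] is not coherent because the action is wild.  As
    [s = y + sigma y] and [t = x + sigma x] are coprime in [S], the colon
    ideal [(s, t) : u] is exactly the image of the trace [e |-> e + sigma e]
    ([colon_trace]).  This holds at every level of the perfection, where the
    union of the trace ideals is stable under square roots; it is therefore
    idempotent, and by Nakayama's lemma it is not finitely generated, being
    neither zero nor the unit ideal.  Over a coherent ring the colon ideal would
    be finitely generated ([coherent_colon]).

    The remaining properties are commutative algebra.  [A] is Noetherian
    ([ps_noetherian]), hence so are its finite extensions ([qd_noetherian]);
    [S] has greatest common divisors since [S / x] is a discrete valuation ring
    ([gcds_of_quotient]); thus [S] is integrally closed, and so is [R]; the
    powers of the maximal ideal of [R] are computed on coefficients, which gives
    completeness ([quad_complete_local]). *)

(** * Ideals and Nakayama's lemma *)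

Section IdealTheory.
Context (A : comNzRingType).
Implicit Types (I J : set A) (s : seq A).

Lemma ideal0 I : is_ideal I -> I 0. Proof. by case. Qed.

Lemma idealD I x y : is_ideal I -> I x -> I y -> I (x + y).
Proof. by case=> _ + _; apply. Qed.

Lemma idealMl I c x : is_ideal I -> I x -> I (c * x).
Proof. by case=> _ _; apply. Qed.

Lemma idealMr I c x : is_ideal I -> I x -> I (x * c).
Proof. by rewrite mulrC; apply: idealMl. Qed.

Lemma idealN I x : is_ideal I -> I x -> I (- x).
Proof. by move=> iI Ix; rewrite -mulN1r; apply: idealMl. Qed.

Lemma idealB I x y : is_ideal I -> I x -> I y -> I (x - y).
Proof. by move=> iI Ix Iy; apply: idealD => //; apply: idealN. Qed.

Lemma ideal_sum I (T : Type) (r : seq T) (P : pred T) (F : T -> A) :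
  is_ideal I -> (forall i, P i -> I (F i)) -> I (\sum_(i <- r | P i) F i).
Proof.
move=> iI IF; apply: (big_ind I) => //; first exact: ideal0.
by move=> x y; apply: idealD.
Qed.

Lemma range_ideal (c : A) : is_ideal (range ( *%R c)).
Proof.
split; first by exists 0; rewrite ?mulr0.
- by move=> _ _ [x _ <-] [y _ <-]; exists (x + y); rewrite ?mulrDr.
- by move=> a _ [x _ <-]; exists (a * x) => //; rewrite mulrCA.
Qed.

(** Defined as an intersection of ideals, so that membership is eliminated by
    exhibiting an ideal, with no sums to manipulate. *)
Definition gen s : set A :=
  [set x | forall J, is_ideal J -> (forall y, y \in s -> J y) -> J x].

Lemma spanE n (g : 'cV[A]_n) (v : 'rV[A]_n) :
  (v *m g) 0 0 = \sum_i v 0 i * g i 0.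
Proof. by rewrite mxE. Qed.

Lemma span_ideal n (g : 'cV[A]_n) : is_ideal (span g).
Proof.
split; first by exists 0; rewrite mul0mx mxE.
- by move=> _ _ [v ->] [w ->]; exists (v + w); rewrite mulmxDl [RHS]mxE.
- by move=> a _ [v ->]; exists (a *: v); rewrite -scalemxAl [RHS]mxE.
Qed.

Lemma span_mem n (g : 'cV[A]_n) i : span g (g i 0).
Proof.
exists (delta_mx 0 i); rewrite spanE (bigD1 i) //= mxE !eqxx mul1r.
rewrite big1 ?addr0 // => j ji.
by rewrite mxE (negbTE ji) andbF mul0r.
Qed.

Lemma span_min n (g : 'cV[A]_n) J :
  is_ideal J -> (forall i, J (g i 0)) -> span g `<=` J.
Proof.
move=> iJ Jg _ [v ->]; rewrite spanE.
by apply: ideal_sum => // i _; apply: idealMl.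
Qed.

Lemma fin_genP I : is_ideal I ->
  fin_generated I <->
  exists s, (forall y, y \in s -> I y) /\ forall x, I x -> gen s x.
Proof.
move=> iI; split.
  case=> n [g eI]; exists [seq g i 0 | i <- enum 'I_n]; split.
    by move=> _ /mapP[i _ ->]; rewrite eI; apply: span_mem.
  move=> x; rewrite eI => Ix J iJ Js; apply: (span_min iJ _ Ix) => i.
  by apply: Js; apply/mapP; exists i; rewrite ?mem_enum.
case=> s [sI Is]; exists (size s), (\col_i s`_i); apply/seteqP; split.
  move=> x /Is sx; apply: (sx _ (span_ideal _)).
  move=> _ /(nthP 0)[i li <-].
  by have := span_mem (\col_i s`_i) (Ordinal li); rewrite mxE.
by apply: span_min => // i; rewrite mxE; apply/sI/mem_nth.
Qed.

Lemma principal_fin_generated I : principal_ideal I -> fin_generated I.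
Proof.
case=> c ->; apply/fin_genP; first exact: range_ideal.
exists [:: c]; split=> [y|_ [x _ <-] J iJ Jc].
  by rewrite inE => /eqP->; exists 1; rewrite ?mulr1.
by apply: idealMr => //; apply: Jc; rewrite inE.
Qed.

(** The determinant is a polynomial in the entries, hence compatible with
    congruences modulo an ideal. *)
Lemma det_congr I n (M N : 'M[A]_n) : is_ideal I ->
  (forall i j, I (M i j - N i j)) -> I (\det M - \det N).
Proof.
move=> iI IMN; rewrite /determinant -sumrB; apply: ideal_sum => // s _.
rewrite -mulrBr; apply: idealMl => //.
apply: (big_ind2 (fun x y => I (x - y))) => [|x y z w Ixy Izw|i _].
- by rewrite subrr; apply: ideal0.
- rewrite (_ : _ - _ = (x - y) * z + y * (z - w)); last by ring.
  by apply: idealD => //; [apply: idealMr | apply: idealMl].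
- exact: IMN.
Qed.

(** Nakayama's lemma in the form: if [I <= J + a I] then [(1 - c) I <= J] for
    some [c] in [a].  By Cramer's rule [1 - c] can be the determinant of [1 - K],
    where [K] has entries in [a] and expresses the generators of [I] modulo [J].
    In each use below a single product suffices to describe an element of
    [a I], whence the shape of the hypothesis. *)
Lemma nakayama I J a : is_ideal J -> is_ideal a -> is_ideal I ->
    fin_generated I ->
    (forall x, I x -> exists j c y, [/\ J j, a c, I y & x = j + c * y]) ->
  exists2 c, a c & forall x, I x -> J ((1 - c) * x).
Proof.
move=> iJ ia iI [n [g eI]] step.
have /choice[f fP] : forall i, exists p : A * 'rV[A]_n,
    [/\ J p.1, forall k, a (p.2 0 k) & g i 0 = p.1 + (p.2 *m g) 0 0].
  move=> i; have /step[j [c [y []]]] : I (g i 0) by rewrite eI; apply: span_mem.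
  move=> Jj ac; rewrite {1}eI => -[v ->] eg; exists (j, c *: v); split=> //=.
    by move=> k; rewrite mxE; apply: idealMr.
  by rewrite -scalemxAl mxE.
pose h : 'cV[A]_n := \col_i (f i).1.
pose K : 'M[A]_n := \matrix_(i, k) (f i).2 0 k.
have eg : (1%:M - K) *m g = h.
  rewrite mulmxBl mul1mx; apply/colP => i; rewrite !mxE.
  have [_ _ ->] := fP i; rewrite spanE [X in _ - X](_ : _ = \sum_k (f i).2 0 k * g k 0).
    by rewrite addrK.
  by apply: eq_bigr => k _; rewrite mxE.
exists (1 - \det (1%:M - K)).
  rewrite -[X in X - _](@det1 A n); apply: det_congr => // i k.
  by rewrite !mxE opprB addrC subrK; have [] := fP i.
move=> x; rewrite opprB addrC subrK eI => -[v ->].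
have -> : \det (1%:M - K) * (v *m g) 0 0 = (v *m (\adj (1%:M - K) *m h)) 0 0.
  by rewrite -eg (mulmxA (\adj _)) mul_adj_mx mul_scalar_mx -scalemxAr [RHS]mxE.
rewrite spanE; apply: ideal_sum => // i _; apply: idealMl => //.
rewrite mxE; apply: ideal_sum => // k _; apply: idealMl => //.
by rewrite mxE; have [] := fP k.
Qed.

End IdealTheory.

(** * Divisibility *)

Section Coprime.
Context (A : comNzRingType).
Implicit Types (a b c d x y z w : A).

Definition invertible x := exists y, x * y = 1.
Definition regular x := forall y, x * y = 0 -> y = 0.

Lemma regularI x : regular x -> injective ( *%R x).
Proof. by move=> rx y z e; apply/subr0_eq/rx; rewrite mulrBr e subrr. Qed.

Lemma regularX x n : regular x -> regular (x ^+ n).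
Proof.
by move=> rx; elim: n => [|n IH] y; rewrite ?mul1r // exprS -mulrA => /rx/IH.
Qed.

Lemma integral_regular x : GRing.integral_domain_axiom A -> x != 0 -> regular x.
Proof.
by move=> dA nx y e; have /orP[/eqP x0|/eqP//] := dA _ _ e; rewrite x0 eqxx in nx.
Qed.

Lemma integral_exp_neq0 x n :
  GRing.integral_domain_axiom A -> x != 0 -> x ^+ n != 0.
Proof.
move=> dA nx; apply/eqP => e; have /eqP[] := oner_neq0 A.
by apply: (@regularX x n (integral_regular dA nx)); rewrite mulr1.
Qed.

(** For nonzero elements of a domain this says that [a * b] is a least common
    multiple; the cofactor [v] is asked to serve both equations so that the
    notion stays symmetric when [a] or [b] is zero. *)
Definition coprimer a b :=
  forall z w, a * z = b * w -> exists v, z = b * v /\ w = a * v.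

Lemma coprimer_sym a b : coprimer a b -> coprimer b a.
Proof. by move=> cab z w /esym/cab[v [-> ->]]; exists v. Qed.

Lemma coprimer1l b : coprimer 1 b.
Proof. by move=> z w; rewrite mul1r => ->; exists w; rewrite mul1r. Qed.

Lemma coprimerMl a a' b : coprimer a b -> coprimer a' b -> coprimer (a * a') b.
Proof.
move=> c c' z w; rewrite -mulrA => /c[v [/c'[v' [-> ->]] ->]].
by exists v'; rewrite mulrA.
Qed.

Lemma coprimerXl a b n : coprimer a b -> coprimer (a ^+ n) b.
Proof.
move=> cab; elim: n => [|n IH]; first exact: coprimer1l.
by rewrite exprS; apply: coprimerMl.
Qed.

Lemma coprimerX a b m n : coprimer a b -> coprimer (a ^+ m) (b ^+ n).
Proof. by move=> cab; apply/coprimerXl/coprimer_sym/coprimerXl/coprimer_sym. Qed.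

(** In a domain this is equivalent to the principality of all the intersections
    of two principal ideals: [d * a' * b'] generates that of [a] and [b]. *)
Definition has_gcds :=
  forall a b, exists d a' b', [/\ a = d * a', b = d * b' & coprimer a' b'].

(** The fraction [a / b] is integral, with denominators cleared in its monic
    equation. *)
Definition integral_ratio a b := exists (n : nat) (c : nat -> A),
  a ^+ n + \sum_(i < n) c i * a ^+ i * b ^+ (n - i) = 0.

Definition integrally_closed := forall a b, b != 0 -> integral_ratio a b ->
  exists c, a = b * c.

(** Rational root theorem: a fraction in lowest terms that satisfies a monic
    equation has an invertible denominator. *)
Lemma gcds_integrally_closed :
  GRing.integral_domain_axiom A -> has_gcds -> integrally_closed.
Proof.
move=> dA gA a b nb [n [c e]]; have [d [a' [b' [ea eb cab]]]] := gA a b.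
have rd : regular d.
  by apply: integral_regular => //; apply: contra_neq nb; rewrite eb => ->; rewrite mul0r.
have rdn k : regular (d ^+ k) by apply: regularX.
have e' : a' ^+ n * 1 = b' * - \sum_(i < n) c i * a' ^+ i * b' ^+ (n - i).-1.
  apply/eqP; rewrite mulr1 mulrN -subr_eq0 opprK; apply/eqP/(rdn n).
  rewrite -[RHS]e mulrDr -exprMn -ea; congr (_ + _).
  rewrite !mulr_sumr; apply: eq_bigr => i _; rewrite ea eb !exprMn.
  have [k ek] : exists k, (n - i = k.+1)%N.
    by exists (n - i).-1; have := ltn_ord i; lia.
  have -> : d ^+ n = d ^+ i * (d * d ^+ k).
    by rewrite -exprS -exprD -ek; congr (_ ^+ _); have := ltn_ord i; lia.
  by rewrite ek /= [d ^+ k.+1]exprS [b' ^+ k.+1]exprS; ring.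
have [v [ev _]] := coprimerXl cab e'.
by exists (v * a'); rewrite ea eb mulrA -[d * b' * v]mulrA -ev mulr1.
Qed.

(** Krull's intersection theorem for the powers of a regular element [x] of the
    Jacobson radical: their intersection [J] satisfies [J = x J], so it vanishes
    by Nakayama's lemma. *)
Lemma krull_intersection x :
    noetherian A -> regular x -> (forall z, invertible (1 - x * z)) ->
  forall d, (forall n, exists e, d = x ^+ n * e) -> d = 0.
Proof.
move=> nA rx inv d dP; pose J := [set d | forall n, exists e, d = x ^+ n * e].
have iJ : is_ideal J.
  split=> [n|a b Ja Jb n|a b Jb n]; first by exists 0; rewrite mulr0.
    have [e ->] := Ja n; have [f ->] := Jb n.
    by exists (e + f); rewrite mulrDr.
  by have [e ->] := Jb n; exists (a * e); rewrite mulrCA.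
have i0 : is_ideal [set 0 : A].
  by split=> [|a b /= -> ->|a b /= ->] //=; rewrite ?addr0 ?mulr0.
have [|c [z _ <-] cP] := nakayama i0 (range_ideal x) iJ (nA _ iJ).
  move=> a Ja; have [b eb] := Ja 1%N.
  exists 0, x, b; split=> //; first by exists 1; rewrite ?mulr1.
    move=> n; have [e ea] := Ja n.+1; exists e; apply: (regularI rx).
    by rewrite /= mulrA -exprS -ea eb.
  by rewrite add0r eb.
have [v ev] := inv z.
by have /= /(congr1 ( *%R v)) := cP d dP; rewrite mulr0 mulrA (mulrC v) ev mul1r.
Qed.

Lemma separated_factor x : (forall d, (forall n, exists e, d = x ^+ n * e) -> d = 0) ->
  forall d, d != 0 -> exists n e, d = x ^+ n * e /\ ~ exists f, e = x * f.
Proof.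
move=> sep d nd; have [n ndn] : exists n, ~ exists e, d = x ^+ n * e.
  by apply/existsNP => dP; move/eqP: nd; apply; apply: sep.
elim: n ndn => [[]|n IH ndn]; first by exists d; rewrite mul1r.
have [[e ed]|] := pselect (exists e, d = x ^+ n * e); last exact: IH.
exists n, e; split=> // -[f ef]; apply: ndn.
by exists f; rewrite ed ef exprSr mulrA.
Qed.

(** A discrete valuation ring: a nonzero element is a unit times a power of the
    uniformizer [x], and an ideal is generated by the smallest power it
    contains. *)
Lemma uniformizer_pid x : regular x -> (forall d, invertible d \/ exists e, d = x * e) ->
    (forall d, (forall n, exists e, d = x ^+ n * e) -> d = 0) ->
  GRing.integral_domain_axiom A /\ forall I : set A, is_ideal I -> principal_ideal I.
Proof.
move=> rx loc sep.
have rxn n : regular (x ^+ n) by apply: regularX.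
have fac d : d != 0 -> exists n e f, d = x ^+ n * e /\ e * f = 1.
  move=> /(separated_factor sep)[n [e [ed nxe]]].
  by have [[f ef]|//] := loc e; exists n, e, f.
split.
  move=> a b e0; have [//|/fac[n [e [f [ea ef]]]]] := eqVneq a 0.
  apply/eqP; have [//|/fac[m [e' [f' [eb ef']]]]] := eqVneq b 0.
  have /eqP[] := oner_neq0 A.
  apply/(rxn n)/(rxn m); rewrite mulr1.
  transitivity (x ^+ n * (e * f) * x ^+ m * (e' * f')); first by rewrite ef ef'; ring.
  transitivity (x ^+ n * e * (x ^+ m * e') * (f * f')); first by ring.
  by rewrite -ea -eb e0 mul0r.
move=> I iI; have [I0|] := pselect (I `<=` [set 0]).
  exists 0; apply/seteqP; split=> [y /I0 /= ->|_ [y _ <-]].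
    by exists 0; rewrite ?mul0r.
  by rewrite mul0r; apply: ideal0.
move=> /existsNP[d] /not_implyP[Id] /= /eqP /fac[n [e [f [ed ef]]]].
have exn : exists n, `[< I (x ^+ n) >].
  exists n; apply/asboolP; rewrite -[x ^+ n]mulr1 -ef mulrA -ed.
  exact: idealMr.
case: (ex_minnP exn) => m /asboolP Im mP; exists (x ^+ m).
apply/seteqP; split=> [y Iy|_ [y _ <-]]; last exact: idealMr.
have [->|/fac[k [a [b [ea ab]]]]] := eqVneq y 0.
  by exists 0; rewrite ?mulr0.
have /mP mk : `[< I (x ^+ k) >].
  by apply/asboolP; rewrite -[x ^+ k]mulr1 -ab mulrA -ea; apply: idealMr.
by exists (x ^+ (k - m) * a); rewrite // mulrA -exprD subnKC.
Qed.

End Coprime.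

(** A regular local ring of dimension two is factorial.  Only the colon ideals
    [(r : s)] need to be principal.  Dividing by powers of [x] and exchanging
    [r] and [s], one may assume that [x] does not divide [r].  Then [(r : s)] is
    saturated with respect to the prime [x], hence [(r : s) / x (r : s)] embeds
    into the principal ideal domain [D], and Nakayama's lemma lifts a
    generator. *)
Lemma gcds_of_quotient (A D : comNzRingType) (rho : {rmorphism A -> D}) (x : A) :
    noetherian A -> regular x -> (forall z, invertible (1 - x * z)) ->
    (forall d, exists c, rho c = d) ->
    (forall c, rho c = 0 <-> exists e, c = x * e) ->
    GRing.integral_domain_axiom D ->
    (forall I : set D, is_ideal I -> principal_ideal I) ->
  GRing.integral_domain_axiom A /\ has_gcds A.
Proof.
move=> nA rx inv surj ker dD pD.
have sep := krull_intersection nA rx inv.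
have rxn n : regular (x ^+ n) by apply: regularX.
have xprime a b : (exists e, a * b = x * e) -> (exists e, a = x * e) \/ exists e, b = x * e.
  move/ker; rewrite rmorphM => /dD/orP[] /eqP/ker; by [left|right].
have dA : GRing.integral_domain_axiom A.
  move=> a b e0; have [//|/(separated_factor sep)[n [a' [ea na]]]] := eqVneq a 0.
  apply/eqP; have [//|/(separated_factor sep)[m [b' [eb nb]]]] := eqVneq b 0.
  have e : a' * b' = 0.
    by apply/(rxn n)/(rxn m); rewrite -[RHS]e0 ea eb; ring.
  by have [] := xprime a' b' _ => //; exists 0; rewrite mulr0.
split=> //.
have key r s : ~ (exists e, r = x * e) ->
    exists d a' b', [/\ r = d * a', s = d * b' & coprimer a' b'].
  move=> nr; have nz_r : r != 0.
    by apply/eqP => r0; apply: nr; exists 0; rewrite mulr0.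
  (* the colon ideal (r : s) *)
  pose I := [set z | exists w, s * z = r * w].
  have iI : is_ideal I.
    split=> [|a b [w ew] [w' ew']|a b [w ew]]; first by exists 0; rewrite !mulr0.
      by exists (w + w'); rewrite !mulrDr ew ew'.
    by exists (a * w); rewrite mulrCA ew mulrCA.
  have satI z : I (x * z) -> I z.
    case=> w ew; have [|/nr//|[w' ew']] := xprime r w.
      by exists (s * z); rewrite -ew; ring.
    by exists w'; apply: (regularI rx); rewrite /= mulrCA ew ew'; ring.
  have iK : is_ideal (rho @` I).
    split; first by exists 0; rewrite ?rmorph0 //; apply: ideal0.
      move=> _ _ [a Ia <-] [b Ib <-]; exists (a + b); rewrite ?rmorphD //.
      exact: idealD.
    move=> c _ [b Ib <-]; have [a <-] := surj c; exists (a * b); rewrite ?rmorphM //.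
    exact: idealMl.
  have [k ek] := pD _ iK.
  have [g Ig eg] : (rho @` I) k by rewrite ek; exists 1; rewrite ?mulr1.
  have [|c [z _ <-] cP] :=
      nakayama (range_ideal g) (range_ideal x) iI (nA _ iI).
    move=> a Ia; have : (rho @` I) (rho a) by exists a.
    rewrite ek => -[b _]; have [b' <-] := surj b.
    rewrite -eg -rmorphM => /eqP; rewrite eq_sym -subr_eq0 -rmorphB => /eqP/ker[y ey].
    exists (g * b'), x, y; split; first by exists b'.
    - by exists 1; rewrite ?mulr1.
    - by apply: satI; rewrite -ey; apply: idealB => //; apply: idealMr.
    - by rewrite -ey addrC subrK.
  have [v ev] := inv z.
  have Ig' a : I a -> exists b, a = g * b.
    move=> /cP[b _ eb]; exists (v * b).
    by rewrite mulrCA [g * b]eb mulrA [v * _]mulrC ev mul1r.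
  have [r1 er] : exists b, r = g * b by apply: Ig'; exists s; rewrite mulrC.
  have [w0 ew] := Ig.
  have rg : regular g.
    by apply: integral_regular => //; apply: contra_neq nz_r; rewrite er => ->; rewrite mul0r.
  have rr : regular r by apply: integral_regular.
  have es : s = r1 * w0.
    by apply: (regularI rg); rewrite /= mulrC ew er; ring.
  exists r1, g, w0; split=> //; first by rewrite er mulrC.
  move=> a w e; have [|v' ev'] := Ig' w.
    by exists a; rewrite es er -mulrA -e; ring.
  exists v'; split=> //; apply: (regularI rg).
  by rewrite /= e ev'; ring.
move=> r s; have [r0|/(separated_factor sep)[n [r' [er nr]]]] := eqVneq r 0.
  have [s0|ns] := eqVneq s 0.
    exists 0, 1, 1; rewrite r0 s0 mul0r; split=> //; exact: coprimer1l.
  exists s, 0, 1; rewrite r0 mulr0 mulr1; split=> //.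
  exact/coprimer_sym/coprimer1l.
elim: n r s er => [|n IH] r s er.
  by apply: key; rewrite er mul1r.
have [[s1 es]|ns] := pselect (exists e, s = x * e).
  have [d [a [b [ea eb cab]]]] := IH (x ^+ n * r') s1 erefl.
  exists (x * d), a, b; split=> //; last by rewrite es eb mulrA.
  by rewrite er exprS -!mulrA ea.
have [d [a [b [ea eb cab]]]] := key s r ns.
by exists d, b, a; split=> //; apply: coprimer_sym.
Qed.

(** * Formal power series *)

(** The ring [A[[X]]]; the alias keeps apart its ring structure and the pointwise
    one of functions. *)
Definition psr (A : comNzRingType) := nat -> A.

Section PowerSeries.
Context (A : comNzRingType).
Implicit Types f g h : psr A.

HB.instance Definition _ := gen_eqMixin (psr A).
HB.instance Definition _ := gen_choiceMixin (psr A).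

Definition ps_add f g : psr A := fun n => f n + g n.
Definition ps_opp f : psr A := fun n => - f n.
Definition ps_mul f g : psr A := fun n => \sum_(i < n.+1) f i * g (n - i)%N.
Definition psC (c : A) : psr A := fun n => if n is 0 then c else 0.
Definition psX : psr A := fun n => (n == 1%N)%:R.

Fact ps_addA : associative ps_add.
Proof. by move=> f g h; apply/funext => n; rewrite /ps_add addrA. Qed.
Fact ps_addC : commutative ps_add.
Proof. by move=> f g; apply/funext => n; rewrite /ps_add addrC. Qed.
Fact ps_add0 : left_id (psC 0) ps_add.
Proof. by move=> f; apply/funext => -[|n]; rewrite /ps_add add0r. Qed.
Fact ps_addN : left_inverse (psC 0) ps_opp ps_add.
Proof. by move=> f; apply/funext => -[|n]; rewrite /ps_add addNr. Qed.
HB.instance Definition _ :=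
  GRing.isZmodule.Build (psr A) ps_addA ps_addC ps_add0 ps_addN.

Lemma psD f g n : (f + g) n = f n + g n. Proof. by []. Qed.
Lemma psN f n : (- f) n = - f n. Proof. by []. Qed.
Lemma ps0 n : (0 : psr A) n = 0. Proof. by case: n. Qed.

(* Products of power series are computed on polynomial truncations, which
   transfers the ring axioms from polynomials. *)
Let tr n f : {poly A} := \poly_(i < n.+1) f i.

Let mul_tr n k f g : (k <= n)%N -> ps_mul f g k = (tr n f * tr n g)`_k.
Proof.
move=> kn; rewrite coefM; apply: eq_bigr => i _; have := ltn_ord i => ik.
by rewrite !coef_poly !ifT //; lia.
Qed.

Let coefM_congr n (p q r : {poly A}) :
  (forall k, (k <= n)%N -> p`_k = q`_k) -> (p * r)`_n = (q * r)`_n.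
Proof.
by move=> pq; rewrite !coefM; apply: eq_bigr => i _; rewrite pq // -ltnS.
Qed.

Let coef_tr n k f : (k <= n)%N -> (tr n f)`_k = f k.
Proof. by move=> kn; rewrite coef_poly ltnS kn. Qed.

Fact ps_mulC : commutative ps_mul.
Proof.
by move=> f g; apply/funext => n; rewrite !(@mul_tr n) // mulrC.
Qed.

Fact ps_mulA : associative ps_mul.
Proof.
have E f g h n : ps_mul (ps_mul f g) h n = (tr n f * tr n g * tr n h)`_n.
  rewrite (@mul_tr n) //; apply: coefM_congr => k kn.
  by rewrite coef_tr // (mul_tr _ _ kn).
move=> f g h; apply/funext => n; rewrite E ps_mulC E.
by rewrite [in LHS]mulrC mulrA.
Qed.

Lemma psCM c f n : ps_mul (psC c) f n = c * f n.
Proof.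
rewrite /ps_mul big_ord_recl /= subn0 big1 ?addr0 // => i _.
by rewrite /= mul0r.
Qed.

Fact ps_mul1 : left_id (psC 1) ps_mul.
Proof. by move=> f; apply/funext => n; rewrite psCM mul1r. Qed.
Fact ps_mulD : left_distributive ps_mul ps_add.
Proof.
move=> f g h; apply/funext => n; rewrite /ps_mul /ps_add -big_split.
by apply: eq_bigr => i _; rewrite mulrDl.
Qed.
Fact ps_1neq0 : psC 1 != 0.
Proof. by apply/eqP => /(congr1 (@^~ 0%N))/eqP; rewrite /= oner_eq0. Qed.
HB.instance Definition _ := GRing.Zmodule_isComNzRing.Build (psr A)
  ps_mulA ps_mulC ps_mul1 ps_mulD ps_1neq0.

Lemma psME f g n : (f * g) n = \sum_(i < n.+1) f i * g (n - i)%N.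
Proof. by []. Qed.

Lemma psCME c f n : (psC c * f) n = c * f n. Proof. exact: psCM. Qed.

Lemma psXME f n : (psX * f) n = if n is m.+1 then f m else 0.
Proof.
rewrite psME big_ord_recl mul0r add0r; case: n => [|n]; first by rewrite big_ord0.
rewrite big_ord_recl /= mul1r subSS subn0 big1 ?addr0 // => i _.
by rewrite mul0r.
Qed.

Lemma psXn_dvd n f g k : f = psX ^+ n * g -> (k < n)%N -> f k = 0.
Proof.
elim: n f k => // n IH f k ->; rewrite exprS -mulrA psXME.
by case: k => // k; apply: IH.
Qed.

Lemma psX_regular : regular psX.
Proof.
move=> f e; apply/funext => n; rewrite ps0.
by have := psXME f n.+1; rewrite e ps0.
Qed.

Fact psC_zmod : zmod_morphism psC.
Proof. by move=> c d; apply/funext => -[|n]; rewrite // psD psN /= subr0. Qed.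
Fact psC_monoid : monoid_morphism psC.
Proof. by split=> // c d; apply/funext => -[|n]; rewrite psCME //= mulr0. Qed.
HB.instance Definition _ := GRing.isZmodMorphism.Build A (psr A) psC psC_zmod.
HB.instance Definition _ := GRing.isMonoidMorphism.Build A (psr A) psC psC_monoid.

Definition coef0 f := f 0%N.
Fact coef0_zmod : zmod_morphism coef0. Proof. by []. Qed.
Fact coef0_monoid : monoid_morphism coef0.
Proof. by split=> // f g; rewrite /coef0 psME big_ord1. Qed.
HB.instance Definition _ := GRing.isZmodMorphism.Build (psr A) A coef0 coef0_zmod.
HB.instance Definition _ := GRing.isMonoidMorphism.Build (psr A) A coef0 coef0_monoid.

Definition ps_tail f : psr A := fun n => f n.+1.

Lemma ps_split f : f = psC (f 0%N) + psX * ps_tail f.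
Proof. by apply/funext => -[|n]; rewrite psD psXME /= ?addr0 ?add0r. Qed.

Lemma psX_dvd f : f 0%N = 0 -> f = psX * ps_tail f.
Proof. by move=> f0; rewrite {1}[f]ps_split f0 rmorph0 add0r. Qed.

(** Division by [g], one coefficient of the quotient [c] at a time; [e n] is the
    remainder after [n] steps.  No convergence argument is needed, as the [c n]
    are constants. *)
Lemma ps_long_division (c : nat -> A) (e : nat -> psr A) g :
  (forall n, e n = psC (c n) * g + psX * e n.+1) -> e 0%N = (c : psr A) * g.
Proof.
move=> ec; pose sc n : psr A := fun k => c (n + k)%N.
have scE n : sc n = psC (c n) + psX * sc n.+1.
  rewrite {1}[sc n]ps_split /sc addn0; congr (_ + psX * _).
  by apply/funext => k; rewrite /ps_tail addnS.
have dE n k : (e n - sc n * g) k = 0.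
  elim: k n => [|k IH] n; rewrite ec scE;
    (rewrite (_ : _ - _ = psX * (e n.+1 - sc n.+1 * g)); last by ring);
    by rewrite psXME.
by apply/subr0_eq/funext => k; rewrite [LHS]dE ps0.
Qed.

(** Long division of [1] by [f]. *)
Lemma ps_invertible f : invertible (f 0%N) -> invertible f.
Proof.
case=> u fu; pose nxt (e : psr A) := ps_tail (e - psC (u * e 0%N) * f).
pose e n := iter n nxt 1; exists (fun n => u * e n 0%N).
rewrite mulrC -[1]/(e 0%N); apply/esym/ps_long_division => n.
rewrite [e n.+1]/(nxt (e n)) -psX_dvd ?subrKC //.
by rewrite psD psN psCME mulrAC (mulrC u) fu mul1r subrr.
Qed.

(** Let [I : X^n] be the ideal of the [f] such that [X^n f] is in [I], and [L n]
    the ideal of their constant coefficients.  The union of the increasing [L n]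
    is principal, hence equal to [L N] for some [N].  Then [I : X^N] is
    principal by long division, and one climbs down from [N] to [0] adding one
    generator at each step. *)
Lemma ps_noetherian :
  (forall I : set A, is_ideal I -> principal_ideal I) -> noetherian (psr A).
Proof.
move=> pA I iI; pose J n := [set f | I (psX ^+ n * f)].
have iJ n : is_ideal (J n).
  split=> [|f g Jf Jg|f g Jg]; rewrite /J /= ?mulr0; first exact: ideal0.
    by rewrite mulrDr; apply: idealD.
  by rewrite mulrCA; apply: idealMl.
have JX n f : J n (psX * f) <-> J n.+1 f by rewrite /J /= mulrA -exprSr.
have Jle n k f : J n f -> J (n + k)%N f.
  move=> Jf; elim: k => [|k IH]; rewrite ?addn0 // addnS.
  by apply/JX; apply: idealMl.
have iL n : is_ideal (coef0 @` J n).
  split; first by exists 0; rewrite ?rmorph0 //; apply: ideal0.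
    move=> _ _ [f Jf <-] [g Jg <-]; exists (f + g); rewrite ?rmorphD //.
    exact: idealD.
  by move=> a _ [g Jg <-]; exists (psC a * g); rewrite ?rmorphM //; apply: idealMl.
pose U := [set a | exists n, (coef0 @` J n) a].
have iU : is_ideal U.
  split; first by exists 0%N; apply: ideal0.
    move=> a b [n [f Jf fa]] [m [g Jg gb]]; exists (n + m)%N.
    apply: idealD => //; [exists f => //; exact: Jle|exists g => //].
    by rewrite addnC; apply: Jle.
  by move=> a b [n nb]; exists n; apply: idealMl.
have [b eU] := pA _ iU.
have [N [g JNg gb]] : U b by rewrite eU; exists 1; rewrite ?mulr1.
have JN f : J N f -> exists c, f = c * g.
  move=> JNf.
  have /choice[q qP] : forall a, exists c, (U a -> a = b * c).
    move=> a; have [|nUa] := pselect (U a); last by exists 0.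
    by rewrite {1}eU => -[c _ <-]; exists c.
  pose nxt (e : psr A) := ps_tail (e - psC (q (e 0%N)) * g).
  pose e n := iter n nxt f.
  have nxtE n h : J (N + n)%N h -> h = psC (q (h 0%N)) * g + psX * nxt h.
    move=> Jh; rewrite -psX_dvd ?subrKC // psD psN psCME.
    have /qP {1}-> : U (h 0%N) by exists (N + n)%N, h.
    by rewrite [g 0%N]gb mulrC subrr.
  have Je n : J (N + n)%N (e n).
    elim: n => [|n IH]; first by rewrite addn0.
    rewrite addnS; apply/JX.
    have -> : psX * e n.+1 = e n - psC (q (e n 0%N)) * g.
      by rewrite {1}(nxtE _ _ IH) addrAC subrr add0r.
    by apply: idealB => //; apply: idealMl => //; apply: Jle.
  exists (fun n => q (e n 0%N)); rewrite -[f]/(e 0%N).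
  by apply: ps_long_division => n; apply: nxtE (Je n).
have fgJ k : (k <= N)%N -> fin_generated (J (N - k)%N).
  elim: k => [|k IH] kN; apply/fin_genP => //.
    rewrite subn0; exists [:: g]; split=> [y|f /JN[c ->] K iK Kg].
      by rewrite inE => /eqP->.
    by apply: idealMl => //; apply: Kg; rewrite inE.
  have {IH} /fin_genP[//|s [sJ Js]] := IH (ltnW kN).
  set n := (N - k.+1)%N; have nS : (N - k = n.+1)%N by rewrite /n; lia.
  rewrite nS in sJ Js; have [a ea] := pA _ (iL n).
  have [h Jh ha] : (coef0 @` J n) a by rewrite ea; exists 1; rewrite ?mulr1.
  exists (h :: [seq psX * f | f <- s]); split.
    move=> y; rewrite inE => /orP[/eqP->//|/mapP[f fs ->]].
    by apply/JX/sJ.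
  move=> f Jf K iK Ks.
  have [c _ ec] : range ( *%R a) (f 0%N) by rewrite -ea; exists f.
  have f0 : (f - psC c * h) 0%N = 0.
    by rewrite psD psN psCME -ec [h 0%N]ha mulrC subrr.
  rewrite -[f](subrK (psC c * h)); apply: idealD => //; last first.
    by apply: idealMl => //; apply: Ks; rewrite mem_head.
  have Jf' : J n (f - psC c * h) by apply: idealB => //; apply: idealMl.
  rewrite (psX_dvd f0) in Jf' *; have /Js := (JX _ _).1 Jf'.
  move=> /(_ [set f | K (psX * f)]); apply.
    split=> [|u v Ku Kv|u v Kv] /=; rewrite ?mulr0; first exact: ideal0.
      by rewrite mulrDr; apply: idealD.
    by rewrite mulrCA; apply: idealMl.
  by move=> y ys /=; apply: Ks; rewrite inE map_f ?orbT.
have := fgJ N (leqnn N); rewrite subnn (_ : J 0%N = I) //.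
by apply/seteqP; split=> f; rewrite /J /= mul1r.
Qed.

End PowerSeries.

Lemma psC_regular (A : comNzRingType) (c : A) : regular c -> regular (psC c).
Proof.
move=> rc f e; apply/funext => n; rewrite ps0; apply: rc.
by rewrite -psCME e ps0.
Qed.

Lemma ps_sum (A : comNzRingType) (T : Type) (r : seq T) (P : pred T)
    (F : T -> psr A) n :
  (\sum_(i <- r | P i) F i) n = \sum_(i <- r | P i) F i n.
Proof.
exact: (big_morph (fun f : psr A => f n) (fun f g => psD f g n) (@ps0 A n)).
Qed.

(** * Quadratic extensions *)

(** [quad a b] is [A[z] / (z^2 - a z - b)]; the pair [(f, g)] stands for
    [f + g z]. *)
Definition quad (A : comNzRingType) (a b : A) := (A * A)%type.

Section Quadratic.
Context (A : comNzRingType) (a b : A).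
Implicit Types p q r : quad a b.

HB.instance Definition _ := GRing.Zmodule.on (quad a b).

Definition qd_one : quad a b := (1, 0).
Definition qd_mul p q : quad a b :=
  (p.1 * q.1 + b * (p.2 * q.2), p.1 * q.2 + p.2 * q.1 + a * (p.2 * q.2)).

Fact qd_mulA : associative qd_mul.
Proof. by move=> [? ?] [? ?] [? ?]; rewrite /qd_mul /=; congr pair; ring. Qed.
Fact qd_mulC : commutative qd_mul.
Proof. by move=> [? ?] [? ?]; rewrite /qd_mul /=; congr pair; ring. Qed.
Fact qd_mul1 : left_id qd_one qd_mul.
Proof. by move=> [? ?]; rewrite /qd_mul /=; congr pair; ring. Qed.
Fact qd_mulD : left_distributive qd_mul +%R.
Proof. by move=> [? ?] [? ?] [? ?]; rewrite /qd_mul /=; congr pair; rewrite /=; ring. Qed.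
Fact qd_1neq0 : qd_one != 0.
Proof. by apply/eqP => -[/eqP]; rewrite oner_eq0. Qed.
HB.instance Definition _ := GRing.Zmodule_isComNzRing.Build (quad a b)
  qd_mulA qd_mulC qd_mul1 qd_mulD qd_1neq0.

Lemma qdME p q : p * q =
  (p.1 * q.1 + b * (p.2 * q.2), p.1 * q.2 + p.2 * q.1 + a * (p.2 * q.2)).
Proof. by []. Qed.
Lemma qdDE p q : p + q = (p.1 + q.1, p.2 + q.2). Proof. by []. Qed.
Lemma qdNE p : - p = (- p.1, - p.2). Proof. by []. Qed.

Definition qdC (c : A) : quad a b := (c, 0).
Definition qdZ : quad a b := (0, 1).

Fact qdC_zmod : zmod_morphism qdC.
Proof. by move=> c d; rewrite qdDE /= subr0. Qed.
Fact qdC_monoid : monoid_morphism qdC.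
Proof. by split=> // c d; rewrite qdME /qdC /=; congr pair; ring. Qed.
HB.instance Definition _ := GRing.isZmodMorphism.Build A (quad a b) qdC qdC_zmod.
HB.instance Definition _ := GRing.isMonoidMorphism.Build A (quad a b) qdC qdC_monoid.

Lemma qd_split p : p = qdC p.1 + qdC p.2 * qdZ.
Proof. by case: p => f g; rewrite qdME qdDE /=; congr pair; ring. Qed.

Lemma qdZ2 : qdZ * qdZ = qdC a * qdZ + qdC b.
Proof. by rewrite !qdME qdDE /=; congr pair; ring. Qed.

Lemma qd_morphZ2 (C : comNzRingType) (f : {rmorphism quad a b -> C}) :
  f qdZ * f qdZ = f (qdC a) * f qdZ + f (qdC b).
Proof. by rewrite -!rmorphM -rmorphD qdZ2. Qed.

Lemma qdCM c p : qdC c * p = (c * p.1, c * p.2).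
Proof. by rewrite qdME /=; congr pair; ring. Qed.

Lemma qdZM p : qdZ * p = (b * p.2, p.1 + a * p.2).
Proof. by rewrite qdME /=; congr pair; ring. Qed.

Lemma qdC_regular c : regular c -> regular (qdC c).
Proof. by move=> rc [f g]; rewrite qdCM => -[/rc-> /rc->]. Qed.

Lemma qdZ_regular : regular b -> regular qdZ.
Proof.
move=> rb [f g]; rewrite qdZM => -[/= /rb -> ] /eqP.
by rewrite mulr0 addr0 => /eqP->.
Qed.

Lemma qdC_coprimer c d : coprimer c d -> coprimer (qdC c) (qdC d).
Proof.
move=> cd [f g] [f' g']; rewrite !qdCM => -[/= /cd[v [-> ->]] /cd[w [-> ->]]].
by exists (v, w); rewrite !qdCM.
Qed.

(** An ideal [I] of [A + A z] is an extension of the ideal of the coefficients of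
    [z] by the intersection of [I] with [A]. *)
Lemma qd_noetherian : noetherian A -> noetherian (quad a b).
Proof.
move=> nA I iI.
have iA0 (K : set (quad a b)) : is_ideal K -> is_ideal [set f | K (qdC f)].
  move=> iK; split=> [|f g Kf Kg|f g Kg] /=; rewrite ?rmorph0; first exact: ideal0.
    by rewrite rmorphD; apply: idealD.
  by rewrite rmorphM; apply: idealMl.
have iA1 (K : set (quad a b)) : is_ideal K ->
    is_ideal [set g | exists2 p : quad a b, K p & p.2 = g].
  move=> iK; split=> [|_ _ [p Kp <-] [q Kq <-]|f _ [q Kq <-]] /=.
  - by exists 0 => //; apply: ideal0.
  - by exists (p + q) => //; apply: idealD.
  - by exists (qdC f * q); [apply: idealMl | rewrite qdCM].
have /fin_genP[|s0 [s0I Is0]] := nA _ (iA0 _ iI); first exact: iA0.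
have /fin_genP[|s1 [s1I Is1]] := nA _ (iA1 _ iI); first exact: iA1.
have /choice[l lP] : forall g, exists p : quad a b, g \in s1 -> I p /\ p.2 = g.
  move=> g; have [/s1I[p Ip pg]|] := boolP (g \in s1); first by exists p.
  by exists 0.
apply/fin_genP => //; exists ([seq l g | g <- s1] ++ [seq qdC f | f <- s0]); split.
  by move=> p; rewrite mem_cat => /orP[] /mapP[g gs ->]; [case: (lP g gs)|apply: s0I].
move=> p Ip K iK Ks.
have iIK : is_ideal (I `&` K).
  split=> [|x y [? ?] [? ?]|x y [? ?]]; first by split; apply: ideal0.
    by split; apply: idealD.
  by split; apply: idealMl.
have I2 : exists2 q : quad a b, I q & q.2 = p.2 by exists p.
have [|q [Iq Kq] qp] := Is1 p.2 I2 _ (iA1 _ iIK).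
  move=> g gs /=; have [Il lg] := lP g gs; exists (l g) => //; split=> //.
  by apply: Ks; rewrite mem_cat map_f.
have epq : qdC (p.1 - q.1) = p - q by rewrite qdDE /= qp subrr.
have := Is0 (p.1 - q.1); rewrite /= epq => /(_ (idealB iI Ip Iq) _ (iA0 _ iK)).
rewrite /= epq => Kpq; rewrite -(subrK q p); apply: idealD => //; apply: Kpq.
by move=> f fs; apply: Ks; rewrite mem_cat map_f ?orbT.
Qed.

(** The universal property of [A[z]]: [z] may be sent to any root of its equation
    in a ring over [A]. *)
Definition qd_lift (C : comNzRingType) (phi : {rmorphism A -> C}) (z : C)
    of z * z = phi a * z + phi b :=
  fun p : quad a b => phi p.1 + phi p.2 * z.

Section Lift.
Context (C : comNzRingType) (phi : {rmorphism A -> C}) (z : C).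
Context (hz : z * z = phi a * z + phi b).

Fact qd_lift_zmod : zmod_morphism (qd_lift hz).
Proof. by move=> p q; rewrite /qd_lift /= !rmorphB; ring. Qed.
Fact qd_lift_monoid : monoid_morphism (qd_lift hz).
Proof.
split=> [|p q]; first by rewrite /qd_lift rmorph1 rmorph0 mul0r addr0.
rewrite /qd_lift qdME /= !(rmorphD, rmorphM).
transitivity (phi p.1 * phi q.1 + (phi p.1 * phi q.2 + phi p.2 * phi q.1) * z +
  phi p.2 * phi q.2 * (z * z)); last by ring.
by rewrite hz; ring.
Qed.
HB.instance Definition _ :=
  GRing.isZmodMorphism.Build (quad a b) C (qd_lift hz) qd_lift_zmod.
HB.instance Definition _ :=
  GRing.isMonoidMorphism.Build (quad a b) C (qd_lift hz) qd_lift_monoid.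

Lemma qd_liftE p : qd_lift hz p = phi p.1 + phi p.2 * z. Proof. by []. Qed.

End Lift.

(** The norm of [p], its product with its conjugate, is a unit as soon as the
    following element of [A] is one. *)
Lemma qd_invertible p :
  invertible (p.1 ^+ 2 + a * p.1 * p.2 - b * p.2 ^+ 2) -> invertible p.
Proof.
case=> u eu; exists (qdC u * (p.1 + a * p.2, - p.2)).
rewrite qdCM qdME /= -[1]/(1, 0); congr pair; last by ring.
by rewrite -eu; ring.
Qed.

End Quadratic.

Lemma vieta_root (C : comNzRingType) (c d z : C) :
  z * z = c * z + d -> (c - z) * (c - z) = c * (c - z) + d.
Proof.
move=> e; transitivity (c * c - c * z *+ 2 + z * z); first by ring.
by rewrite e; ring.
Qed.

(** An endomorphism [tau] of [A] fixing [a] and [b] extends to [A[z]] by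
    exchanging the roots [z] and [a - z]. *)
Section Conjugation.
Context (A : comNzRingType) (a b : A) (tau : {rmorphism A -> A}).
Hypotheses (tau_a : tau a = a) (tau_b : tau b = b).

Fact qd_conj_root : let z := qdC a b a - qdZ a b in
  z * z = (@qdC A a b \o tau) a * z + (@qdC A a b \o tau) b.
Proof.
by rewrite /= tau_a tau_b; apply: vieta_root; apply: qdZ2.
Qed.

Definition qd_conj := qd_lift qd_conj_root.
HB.instance Definition _ := GRing.RMorphism.on qd_conj.

Lemma qd_conjE p : qd_conj p = (tau p.1 + a * tau p.2, - tau p.2).
Proof.
rewrite /qd_conj qd_liftE /= qdCM !qdDE qdNE /qdC /qdZ /=.
by congr pair; ring.
Qed.

Lemma qd_conjC c : qd_conj (qdC a b c) = qdC a b (tau c).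
Proof. by rewrite qd_conjE /= rmorph0 /qdC; congr pair; ring. Qed.

Lemma qd_conjK : involutive tau -> involutive qd_conj.
Proof.
move=> tauK [f g]; rewrite !qd_conjE /= rmorphD rmorphM rmorphN !tauK tau_a.
by congr pair; ring.
Qed.

End Conjugation.

(** * Local rings and completeness *)

(** [A] is a local ring with residue map [eps]. *)
Definition local_aug (A : comNzRingType) (k : fieldType) (eps : {rmorphism A -> k}) :=
  forall c, eps c != 0 -> invertible c.

Lemma local_aug_jacobson (A : comNzRingType) (k : fieldType)
  (eps : {rmorphism A -> k}) x : local_aug eps -> eps x = 0 ->
  forall z, invertible (1 - x * z).
Proof.
by move=> loc x0 z; apply: loc; rewrite rmorphB rmorph1 rmorphM x0 mul0r subr0 oner_neq0.
Qed.

(** When [a] and [b] are in the maximal ideal, [z^2 - a z - b] has zero as its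
    only root in the residue field, so [A[z]] stays local with the same residue
    field. *)
Lemma qd_local_aug (A : comNzRingType) (a b : A) (k : fieldType)
    (eps : {rmorphism A -> k}) (h : 0 * 0 = eps a * 0 + eps b) :
  local_aug eps -> eps a = 0 -> local_aug (qd_lift h).
Proof.
move=> loc a0 p /=; rewrite qd_liftE mulr0 addr0 => np; apply/qd_invertible/loc.
have b0 : eps b = 0 by move: h; rewrite !mulr0 add0r => <-.
by rewrite !(rmorphB, rmorphD, rmorphM) /= a0 b0 !mul0r subr0 addr0 mulf_neq0.
Qed.

Section CompleteLocal.
Context (A : comNzRingType) (k : fieldType) (eps : {rmorphism A -> k}).
Hypothesis loc : local_aug eps.
Local Notation m := [set c | eps c = 0].

Lemma local_aug_complete : adically_complete m -> complete_local A.
Proof.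
have im : is_ideal m.
  split=> [|a b /= a0 b0|a b /= b0] /=; first by rewrite rmorph0.
    by rewrite rmorphD a0 b0 addr0.
  by rewrite rmorphM b0 mulr0.
have m1 : ~ m 1 by rewrite /= rmorph1; apply/eqP/oner_neq0.
have proper (I : set A) : is_ideal I -> ~ I 1 -> I `<=` m.
  move=> iI I1 c Ic /=; apply/eqP; apply: contraT => /loc[d cd].
  by case: I1; rewrite -cd; apply: idealMr.
move=> cm; exists m; split=> //.
  by split=> // I iI mI I1; apply/seteqP; split=> //; apply: proper.
move=> m' [im' m'1 max]; apply/esym/max => //; exact: proper.
Qed.

End CompleteLocal.

Lemma ideal_exp_filtration (A : comNzRingType) (m : set A) (G : nat -> set A) :
    G 0%N = setT -> (forall n, ideal_mul m (G n) = G n.+1) ->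
  forall n, ideal_exp m n = G n.
Proof.
move=> G0 GS; elim=> [|n IH]; first by rewrite G0.
by rewrite -GS -IH.
Qed.

Lemma ps_local_aug (A : comNzRingType) (k : fieldType) (eps : {rmorphism A -> k}) :
  local_aug eps -> local_aug (eps \o @coef0 A).
Proof. by move=> loc f /= nf; apply/ps_invertible/loc. Qed.

Lemma id_local_aug (k : fieldType) : local_aug (idfun : {rmorphism k -> k}).
Proof. by move=> c /= nc; exists c^-1; rewrite mulfV. Qed.

Section Order.
Context (A : comNzRingType).
Implicit Types f g : psr (psr A).

(** The [n]-th power of the ideal [(s, t)] of [A[[t]][[s]]], described on
    coefficients; the outer variable [s] is [psX] and the inner one [t] is the
    constant [psC psX]. *)
Definition order_ge n f := forall i j, (i + j < n)%N -> f i j = 0.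

Lemma order_geD n f g : order_ge n f -> order_ge n g -> order_ge n (f + g).
Proof. by move=> of_ og i j ij; rewrite psD psD of_ // og // addr0. Qed.

Lemma order_ge0 n : order_ge n 0.
Proof. by move=> i j _; rewrite !ps0. Qed.

Lemma order_geM m n f g : order_ge m f -> order_ge n g -> order_ge (m + n) (f * g).
Proof.
move=> of_ og i j ij; rewrite psME ps_sum big1 // => a _; rewrite psME big1 // => b _.
have [abm|mab] := ltnP (a + b) m; first by rewrite of_ // mul0r.
by rewrite og ?mulr0 //; have := ltn_ord a; have := ltn_ord b; lia.
Qed.

Lemma order_ge_le m n f : (m <= n)%N -> order_ge n f -> order_ge m f.
Proof. by move=> mn of_ i j ij; apply: of_; apply: leq_trans mn. Qed.

Lemma order_geX : order_ge 1 (psX (psr A)).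
Proof. by move=> [|i] [|j]. Qed.

Lemma order_geC : order_ge 1 (psC (psX A)).
Proof. by move=> [|i] [|j]. Qed.

(** Separate the terms divisible by [s] from those divisible by [t]. *)
Lemma order_ge_split n f : order_ge n.+1 f -> exists f1 f2,
  [/\ order_ge n f1, order_ge n f2 & f = psX _ * f1 + psC (psX A) * f2].
Proof.
move=> of_; exists (ps_tail f), (psC (ps_tail (f 0%N))); split.
- by move=> i j ij; apply: of_.
- by move=> [|i] j ij; [apply: of_ | exact: ps0].
- rewrite -rmorphM -(psX_dvd (f := f 0%N)); first by rewrite addrC -ps_split.
  exact: of_.
Qed.

End Order.

Section CompleteQuad.
Context (k : fieldType) (a b : psr (psr k)).
Hypotheses (oa : order_ge 1 a) (ob : order_ge 2 b).
Local Notation eps :=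
  (((idfun : {rmorphism k -> k}) \o @coef0 k) \o @coef0 (psr k)).

Fact complete_root : 0 * 0 = eps a * 0 + eps b.
Proof. by rewrite !mulr0 add0r /= /coef0 ob. Qed.

Local Notation Q := (quad a b).
Local Notation m := [set p : Q | qd_lift complete_root p = 0].

(** In terms of the basis [1, z], the [n]-th power of the maximal ideal [m] of
    [Q] consists of the elements whose components have order at least [n] and
    [n - 1] respectively: the generator [z] counts with weight one. *)
Let G n : set Q := [set p | order_ge n p.1 /\ order_ge n.-1 p.2].

Let mE p : m p <-> G 1 p.
Proof.
rewrite /= qd_liftE mulr0 addr0 /=; split=> [p0|[]].
  by split=> // -[|i] [|j].
by move=> p1 _; apply: (p1 0%N 0%N).
Qed.

Let GD n p q : G n p -> G n q -> G n (p + q).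
Proof. by move=> [? ?] [? ?]; split; apply: order_geD. Qed.

Let GM n p q : G 1 p -> G n q -> G n.+1 (p * q).
Proof.
move=> [p1 p2] [q1 q2]; rewrite qdME; split=> /=.
  apply: order_geD; first exact: (order_geM p1 q1).
  apply: (order_ge_le _ (order_geM ob (order_geM p2 q2))); lia.
apply: order_geD; first apply: order_geD.
- apply: (order_ge_le _ (order_geM p1 q2)); lia.
- exact: (order_geM p2 q1).
- apply: (order_ge_le _ (order_geM oa (order_geM p2 q2))); lia.
Qed.

Let GS n p : G n.+1 p -> ideal_mul m (G n) p.
Proof.
have mC c : order_ge 1 c -> m (qdC a b c).
  by move=> oc; apply/mE; split=> //= i j _; rewrite !ps0.
move=> [p1 p2]; have [f1 [f2 [o1 o2 ep1]]] := order_ge_split p1.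
have mX := mC _ (@order_geX k); have mT := mC _ (@order_geC k).
case: n => [|n] in p1 p2 o1 o2 *.
  exists [:: (qdC a b (psX _), (f1, 0)); (qdC a b (psC (psX k)), (f2, 0));
    (qdZ a b, (p.2, 0))]; split.
    move=> ab; rewrite !inE => /or3P[] /eqP->; split=> //=.
    by rewrite qd_liftE rmorph0 mulr0 addr0.
  rewrite !big_cons big_nil !qdCM qdZM !qdDE /= !(mulr0, addr0, add0r).
  by rewrite -ep1; case: (p).
have [g1 [g2 [h1 h2 ep2]]] := order_ge_split p2.
exists [:: (qdC a b (psX _), (f1, g1)); (qdC a b (psC (psX k)), (f2, g2))]; split.
  by move=> ab; rewrite !inE => /orP[] /eqP->.
rewrite !big_cons big_nil addr0 !qdCM qdDE /= -ep1 -ep2.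
by case: (p).
Qed.

Let expE n : ideal_exp m n = G n.
Proof.
move: n; apply: ideal_exp_filtration => [|n].
  by apply/seteqP; split=> // p _; split=> i j.
apply/seteqP; split=> [p [r [rP ->]]|]; last exact: GS.
rewrite big_seq; apply: (big_ind (G n.+1)) => [|q q'|ab /rP[/mE ? ?]].
- by split; apply: order_ge0.
- exact: GD.
- exact: GM.
Qed.

(** Limits are taken coefficientwise: the coefficients of total degree below [n]
    no longer move after the [n]-th term, respectively the one after it for the
    component of [z]. *)
Lemma quad_complete_local : complete_local Q.
Proof.
have loc : local_aug (qd_lift complete_root).
  apply: qd_local_aug; first exact/ps_local_aug/ps_local_aug/id_local_aug.
  exact: oa.
apply: (local_aug_complete loc); split=> [p pP|u uP].
  rewrite [p]surjective_pairing; congr pair; apply/funext => i; apply/funext => j.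
    by have := pP (i + j).+1; rewrite expE => -[+ _]; rewrite !ps0; apply.
  by have := pP (i + j).+2; rewrite expE => -[_ +]; rewrite !ps0; apply.
have st1 d i j : (u ((i + j).+1 + d)%N).1 i j = (u (i + j).+1).1 i j.
  elim: d => [|d IH]; rewrite ?addn0 // addnS -IH; apply/subr0_eq.
  by have := uP ((i + j).+1 + d)%N; rewrite expE => -[/(_ i j) + _]; apply; lia.
have st2 d i j : (u ((i + j).+2 + d)%N).2 i j = (u (i + j).+2).2 i j.
  elim: d => [|d IH]; rewrite ?addn0 // addnS -IH; apply/subr0_eq.
  by have := uP ((i + j).+2 + d)%N; rewrite expE => -[_ /(_ i j)]; apply; lia.
exists (fun i j => (u (i + j).+1).1 i j, fun i j => (u (i + j).+2).2 i j) => n.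
rewrite expE; split=> i j ij /=; rewrite psD psD !psN.
  by rewrite -(st1 (n - (i + j).+1)%N) subnKC ?subrr //; lia.
by rewrite -(st2 (n - (i + j).+2)%N) subnKC ?subrr //; lia.
Qed.

End CompleteQuad.

(** * Perfections *)

Section Perfection.
Context (R : comNzRingType) (p : nat) (hp : p \in [pchar R]).
Hypothesis dR : GRing.integral_domain_axiom R.
Local Notation phi := (pFrobenius_aut hp).
Local Notation Rperf := (perfection hp).
Local Notation inc := (to_colim phi).

Lemma iter_frobenius k x : iter k phi x = x ^+ (p ^ k).
Proof.
elim: k => [|k IH] /=; first by rewrite expr1.
by rewrite IH pFrobenius_autE -exprM -expnSr.
Qed.

Lemma frobenius_inj k : injective (iter k phi).
Proof.
move=> x y e; apply/eqP; rewrite -subr_eq0; apply: contraT.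
move/(integral_exp_neq0 (p ^ k) dR).
by rewrite -iter_frobenius iterphiD iterphiN e subrr eqxx.
Qed.

Lemma to_colim_inj n : injective (inc n).
Proof. by move=> x y /to_colim_eq[k] /frobenius_inj. Qed.

Lemma perfection_integral : GRing.integral_domain_axiom Rperf.
Proof.
move=> u v; have [n [a [b [_ [-> -> _]]]]] := colim_level3 u v v.
rewrite -rmorphM -[X in _ = X](rmorph0 (inc n)) => /to_colim_inj/dR.
by case/orP => /eqP->; rewrite rmorph0 eqxx ?orbT.
Qed.

Lemma to_perfD n a b : inc n (a + b) = inc n a + inc n b :> Rperf.
Proof. exact: rmorphD. Qed.

Lemma to_perfM n a b : inc n (a * b) = inc n a * inc n b :> Rperf.
Proof. exact: rmorphM. Qed.

Lemma colim_level_ge n (u v : Rperf) : exists k a b,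
  u = inc (n + k) a /\ v = inc (n + k) b.
Proof.
have [m [a [b [_ [-> -> _]]]]] := colim_level3 u v v.
by exists m, (iter n phi a), (iter n phi b); rewrite addnC !to_colim_shift.
Qed.

(** Coprimality is preserved by Frobenius, so a pair that becomes a multiple of
    a coprime pair after one Frobenius twist has a least common multiple in the
    perfection. *)
Lemma perfection_gcd :
    (forall a b : R, exists d a' b',
      [/\ a ^+ p = d * a', b ^+ p = d * b' & coprimer a' b']) ->
  gcd_domain Rperf.
Proof.
move=> gcdp; split; first exact: perfection_integral.
move=> r s; have [n [a [b [_ [-> -> _]]]]] := colim_level3 r s s.
have [d [a' [b' [ea eb cab]]]] := gcdp a b.
have ha : inc n a = inc n.+1 (d * a') by rewrite -ea -pFrobenius_autE to_colim_phi.
have hb : inc n b = inc n.+1 (d * b') by rewrite -eb -pFrobenius_autE to_colim_phi.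
rewrite ha hb; exists (inc n.+1 (d * a' * b')); apply/seteqP; split; last first.
  move=> _ [x _ <-]; split.
    by exists (inc n.+1 b' * x); rewrite //= mulrA -to_perfM.
  by exists (inc n.+1 a' * x); rewrite //= mulrA -to_perfM mulrAC.
move=> e [[u _ eu] [v _ ev]].
have [k [c [c' [hu hv]]]] := colim_level_ge n.+1 u v; subst u v.
move: eu ev; rewrite -(to_colim_shift phi k n.+1 (d * a'))
  -(to_colim_shift phi k n.+1 (d * b')) -!to_perfM => eu.
rewrite -eu => /to_colim_inj; rewrite !iterphiM -!mulrA.
have [->|nd] := eqVneq d 0.
  move=> _; exists 0 => //=.
  by rewrite !mul0r iterphi0 mul0r mulr0 rmorph0.
have nD : iter k phi d != 0.
  apply/eqP => d0; move/eqP: nd; apply; apply: (@frobenius_inj k).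
  by rewrite iterphi0.
move/(regularI (integral_regular dR nD)).
rewrite !iter_frobenius => /esym/(coprimerX cab)[v [-> _]].
exists (inc (n.+1 + k) v) => //.
by rewrite -(to_colim_shift phi k n.+1 (d * (a' * b'))) -to_perfM !iterphiM
  !iter_frobenius -!mulrA.
Qed.

End Perfection.

(** * Coherence and colon ideals *)

(** Finite presentation does not depend on the choice of generators (Schanuel),
    so over a coherent ring the relations among [s], [t], [u] are finitely
    generated; the colon ideal consists of their third components. *)
Lemma coherent_colon (A : comNzRingType) (s t u : A) : coherent A ->
  fin_generated [set r | exists b c, r * u = s * b + t * c].
Proof.
move=> cohA; pose w : 'cV[A]_3 := \col_i [:: s; t; u]`_i.
have [n [g [eg [m [K KP]]]]] : fin_presented (span w).
  by apply: cohA; [exact: span_ideal | exists 3%N, w].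
have /choice[f fP] : forall i, exists v : 'rV_3, g i 0 = (v *m w) 0 0.
  by move=> i; have : span w (g i 0) by rewrite eg; apply: span_mem.
have /choice[h hP] : forall i, exists v : 'rV_n, w i 0 = (v *m g) 0 0.
  by move=> i; have : span g (w i 0) by rewrite -eg; apply: span_mem.
pose P := \matrix_i f i; pose Q := \matrix_i h i.
have gP : g = P *m w.
  apply/colP => i; rewrite fP !mxE.
  by apply: eq_bigr => j _; rewrite !mxE.
have wQ : w = Q *m g.
  apply/colP => i; rewrite hP !mxE.
  by apply: eq_bigr => j _; rewrite !mxE.
pose M := col_mx (1%:M - Q *m P) (K *m P).
have Kg : K *m g = 0.
  apply/row_matrixP => i; rewrite row_mul row0.
  by apply/KP; exists (delta_mx 0 i); rewrite -rowE.
have Mw : M *m w = 0.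
  by rewrite mul_col_mx mulmxBl mul1mx -!mulmxA -gP -wQ Kg subrr col_mx0.
have syz (v : 'rV_3) : v *m w = 0 -> exists y, v = y *m M.
  rewrite {1}wQ mulmxA => /KP[y ey]; exists (row_mx v y).
  by rewrite mul_row_col mulmxBr mulmx1 !mulmxA ey subrK.
have dotw (v : 'rV_3) : (v *m w) 0 0 =
    v 0 0 * s + v 0 (inord 1) * t + v 0 (inord 2) * u.
  rewrite spanE !big_ord_recl big_ord0 addr0 !mxE /= addrA.
  by congr (_ * _ + _ * _ + _ * _); congr (v _ _); apply/val_inj; rewrite /= ?inordK.
have colM (y : 'rV_(3 + m)) j : (y *m col j M) 0 0 = (y *m M) 0 j.
  by rewrite !mxE; apply: eq_bigr => i _; rewrite !mxE.
exists (3 + m)%N, (col (inord 2) M); apply/seteqP; split=> [r [b [c e]]|_ [y ->]].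
  have [|y ey] := syz (\row_j [:: - b; - c; r]`_j).
    apply/matrixP => i j; rewrite !ord1 dotw !mxE /= !inordK //= e; ring.
  by exists y; rewrite colM -ey mxE inordK.
rewrite colM; exists (- (y *m M) 0 0), (- (y *m M) 0 (inord 1)).
have := dotw (y *m M); rewrite -mulmxA Mw mulmx0 mxE => /esym e.
by apply/subr0_eq; rewrite -[RHS]e; ring.
Qed.

(** * Integral closure in the fraction field *)

Lemma fraction_ratio (R : idomainType) (z : {fraction R}) :
  exists a b : R, b != 0 /\ z * tofrac b = tofrac a.
Proof.
exists (repr z).1, (repr z).2; split; first exact: denom_ratioP.
rewrite -{1}[z]reprK; unlock tofrac; rewrite -[LHS]FracField.pi_mul.
apply/eqmodP; rewrite /= FracField.equivfE /FracField.mulf /=.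
by rewrite !numden_Ratio ?mulf_neq0 ?denom_ratioP ?oner_neq0 // !mulr1 mulrC.
Qed.

(** Multiply the monic equation of [a / b] by a power of [b]. *)
Lemma integrally_closed_normal (R : idomainType) :
  integrally_closed R -> normal_domain R.
Proof.
move=> cR z [f fm /rootP fz]; have [a [b [nb zb]]] := fraction_ratio z.
have [|c ec] := cR a b nb; last first.
  exists c; apply: (mulIf (x := tofrac b)); first by rewrite tofrac_eq0.
  by rewrite zb ec tofracM mulrC.
exists (size f).-1, (fun i => f`_i).
have sf : size f = (size f).-1.+1 by rewrite prednK // size_poly_gt0 monic_neq0.
apply/eqP; rewrite -tofrac_eq0; apply/eqP.
rewrite -[RHS](mul0r (tofrac b ^+ (size f).-1)) -fz horner_coef.
rewrite size_map_poly_id0; last by rewrite tofrac_eq0 lead_coef_eq0 monic_neq0.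
rewrite [in RHS]sf big_ord_recr /= coef_map mulrDl addrC tofracD rmorph_sum mulr_suml /=.
congr (_ + _).
  apply: eq_bigr => i _; rewrite coef_map !tofracM !tofracXn -zb exprMn /=.
  have -> : tofrac b ^+ (size f).-1 = tofrac b ^+ i * tofrac b ^+ ((size f).-1 - i).
    by rewrite -exprD subnKC // ltnW.
  by ring.
by rewrite -lead_coefE (monicP fm) tofrac1 mul1r -exprMn zb tofracXn.
Qed.

(** The inverse function is obtained by choice; the conclusion is an equality of
    ring structures, so that any property of [R] is transported by it. *)
Lemma idomain_of (R : comNzRingType) : GRing.integral_domain_axiom R ->
  exists D : idomainType, (D : comNzRingType) = R.
Proof.
move=> dR.
pose U : {pred R} := [pred x | `[< exists y, y * x = 1 >]].
pose V (x : R) : R := if pselect (exists y, y * x = 1) is left e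
  then projT1 (cid e) else x.
have VU : {in U, left_inverse 1 V *%R}.
  move=> x /asboolP xU; rewrite /V; case: pselect => // e.
  by case: (cid e).
have UP (x y : R) : y * x = 1 -> U x by move=> e; apply/asboolP; exists y.
have V0 : {in [predC U], V =1 id}.
  by move=> x /asboolPn xU; rewrite /V; case: pselect.
pose m1 := GRing.ComNzRing_hasMulInverse.Build R VU UP V0.
pose R1 : comUnitRingType := HB.pack (GRing.ComNzRing.sort R) m1.
pose m2 := GRing.ComUnitRing_isIntegral.Build R1 dR.
pose R2 : idomainType := HB.pack (GRing.ComNzRing.sort R) m1 m2.
exists R2; transitivity (GRing.ComNzRing.Pack (GRing.ComNzRing.class R)) => //.
by case: (R).
Qed.

Lemma idomain_witness (Q : comNzRingType) (hp : 2%N \in [pchar Q]) :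
    GRing.integral_domain_axiom Q -> noetherian Q -> complete_local Q ->
    integrally_closed Q -> gcd_domain (perfection hp) ->
    ~ coherent (perfection hp) ->
  exists (R : idomainType) (hp : 2%N \in [pchar R]),
    [/\ noetherian R, complete_local R, normal_domain R,
        gcd_domain (perfection hp) & ~ coherent (perfection hp)].
Proof.
move=> dQ; have [E eE] := idomain_of dQ; subst Q.
by move=> *; exists E, hp; split=> //; apply: integrally_closed_normal.
Qed.

(** * Invariants of an involution in characteristic two *)

Section Involution.
Context (R S : comNzRingType) (hp : 2%N \in [pchar R]).
Context (iota : {rmorphism R -> S}) (sigma : {rmorphism S -> S}).
Hypothesis dS : GRing.integral_domain_axiom S.
Hypothesis iota_inj : injective iota.
Hypothesis sigmaK : involutive sigma.
Hypothesis sigma_iota : forall r, sigma (iota r) = iota r.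
Hypothesis sigma_fix : forall z, sigma z = z -> exists r, z = iota r.

Let iota_eq0 r : iota r = 0 -> r = 0.
Proof. by move=> e; apply: iota_inj; rewrite rmorph0. Qed.

Lemma invariants_integral : GRing.integral_domain_axiom R.
Proof.
move=> a b e; have /dS : iota a * iota b = 0 by rewrite -rmorphM e rmorph0.
by case/orP => /eqP/iota_eq0->; rewrite eqxx ?orbT.
Qed.

(** A quotient of two invariants is fixed by [sigma], hence again in [R]. *)
Lemma invariant_quotient a b z : a != 0 -> iota b = iota a * z ->
  exists r, z = iota r /\ b = a * r.
Proof.
move=> na e; have nA : iota a != 0.
  by apply: contra_neq na => /iota_eq0.
have [|r ez] := sigma_fix (z := z).
  apply: (regularI (integral_regular dS nA)) => /=.
  by rewrite -{1}(sigma_iota a) -rmorphM -e sigma_iota.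
by exists r; split=> //; apply: iota_inj; rewrite e ez rmorphM.
Qed.

Lemma invariants_integrally_closed : integrally_closed S -> integrally_closed R.
Proof.
move=> cS a b nb [n [c e]]; have nB : iota b != 0 by apply: contra_neq nb => /iota_eq0.
have [|z ez] := cS (iota a) (iota b) nB; last first.
  by have [r [_ ->]] := invariant_quotient nb ez; exists r.
exists n, (iota \o c); rewrite -[RHS](rmorph0 iota) -e rmorphD rmorphXn rmorph_sum.
by congr (_ + _); apply: eq_bigr => i _; rewrite /= !rmorphM !rmorphXn.
Qed.

Lemma invariants_coprimer a b : coprimer (iota a) (iota b) -> coprimer a b.
Proof.
move=> cab z w e; have [v [ez ew]] : exists v, iota z = iota b * v /\ iota w = iota a * v.
  by apply: cab; rewrite -!rmorphM e.
have [a0|na] := eqVneq a 0.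
  have [b0|nb] := eqVneq b 0.
    have [|x [/eqP]] := cab 1 0; first by rewrite a0 b0 rmorph0 !mul0r.
    by rewrite b0 rmorph0 mul0r oner_eq0.
  have [r [er ->]] := invariant_quotient nb ez; exists r; split=> //.
  by apply: iota_inj; rewrite ew er rmorphM.
have [r [er ->]] := invariant_quotient na ew; exists r; split=> //.
by apply: iota_inj; rewrite ez er rmorphM.
Qed.

(** For invariant [a] and [b], the greatest common divisor [d] in [S] is only
    invariant up to a unit [v]; its norm [d * sigma d] is invariant, and equals
    [d ^ 2] up to a unit.  Thus the squares of [a] and [b] do have a greatest
    common divisor among the invariants. *)
Lemma invariants_square_gcd : has_gcds S -> forall a b : R, exists d a' b',
  [/\ a ^+ 2 = d * a', b ^+ 2 = d * b' & coprimer a' b'].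
Proof.
move=> gS a b; have [d [a1 [b1 [ea eb cab]]]] := gS (iota a) (iota b).
have [d0|nd] := eqVneq d 0.
  exists 0, 1, 1; split; last exact: coprimer1l.
    by rewrite (iota_eq0 (r := a)) ?ea ?d0 ?mul0r ?expr0n.
  by rewrite (iota_eq0 (r := b)) ?eb ?d0 ?mul0r ?expr0n.
have nsd : sigma d != 0.
  by apply: contra_neq nd => /(congr1 sigma); rewrite sigmaK rmorph0.
have eqs c c1 : iota c = d * c1 -> d * c1 = sigma d * sigma c1.
  by move=> e; rewrite -rmorphM -e sigma_iota.
have [v [sb sa]] : exists v, sigma b1 = b1 * v /\ sigma a1 = a1 * v.
  apply: cab; apply: (regularI (integral_regular dS nsd)).
  by rewrite /= mulrCA -(eqs _ _ eb) mulrCA [RHS]mulrCA -(eqs _ _ ea); ring.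
have ev : d = sigma d * v.
  have [a10|na1] := eqVneq a1 0; last first.
    apply: (regularI (integral_regular dS na1)) => /=.
    by rewrite mulrC (eqs _ _ ea) sa; ring.
  have [b10|nb1] := eqVneq b1 0.
    have [|x [/eqP]] := cab 1 0; first by rewrite a10 b10 !mul0r.
    by rewrite b10 mul0r oner_eq0.
  apply: (regularI (integral_regular dS nb1)) => /=.
  by rewrite mulrC (eqs _ _ eb) sb; ring.
have esd : sigma d = d * sigma v by rewrite {1}ev rmorphM sigmaK.
have vv : v * sigma v = 1.
  apply: (regularI (integral_regular dS nd)) => /=.
  by rewrite mulr1 [RHS]ev esd; ring.
have cv z : coprimer v z.
  move=> x y e; exists (sigma v * y); rewrite !mulrA vv mul1r; split=> //.
  by rewrite -[x]mul1r -vv mulrAC e; ring.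
have [D eD] : exists D, d * sigma d = iota D.
  by apply: sigma_fix; rewrite rmorphM sigmaK mulrC.
have nD : D != 0.
  apply/eqP => D0; have /dS : d * sigma d = 0 by rewrite eD D0 rmorph0.
  by rewrite (negbTE nd) (negbTE nsd).
have sq c c1 : iota c = d * c1 -> exists w, v * c1 ^+ 2 = iota w /\ c ^+ 2 = D * w.
  move=> e; apply: invariant_quotient => //.
  rewrite rmorphXn e -eD.
  by transitivity (d * (sigma d * v) * c1 ^+ 2); [rewrite -ev|]; ring.
have [a' [ea' ->]] := sq _ _ ea; have [b' [eb' ->]] := sq _ _ eb.
exists D, a', b'; split=> //; apply: invariants_coprimer; rewrite -ea' -eb'.
apply: coprimerMl; first exact: cv.
apply/coprimer_sym/coprimerMl; first exact: cv.
exact/coprimer_sym/coprimerX.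
Qed.

Lemma invariants_perfection_gcd : has_gcds S -> gcd_domain (perfection hp).
Proof.
move=> gS; apply: perfection_gcd; first exact: invariants_integral.
exact: invariants_square_gcd.
Qed.

Section Trace.
Context (s t u : R) (x y : S).
Hypothesis eu : iota u = iota s * x + iota t * y.
Hypothesis ex : x + sigma x = iota t.
Hypothesis ey : y + sigma y = iota s.
Hypothesis cst : coprimer (iota s) (iota t).
Hypothesis nt : t != 0.
Hypothesis trace_neq1 : forall e, e + sigma e <> 1.
Local Notation phi := (pFrobenius_aut hp).
Local Notation Rperf := (perfection hp).
Local Notation inc := (to_colim phi).

Let pS : 2%N \in [pchar S]. Proof. exact: rmorph_pchar hp. Qed.

Let addSS (z : S) : z + z = 0.
Proof. by rewrite -mulr2n mulrn_pchar. Qed.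

Let frobD n (z w : S) : (z + w) ^+ (2 ^ n) = z ^+ (2 ^ n) + w ^+ (2 ^ n).
Proof.
by apply: exprDn_pchar; rewrite pnatX pnatE ?pS.
Qed.

(** If [r x = b + t e] and [r y = c + s e] with [b] and [c] invariant, then
    [r u = s b + t c], and [r] is the trace of [e].  Conversely, as [s] and [t]
    are coprime in [S], a relation [r u = s b + t c] can only come from such an
    [e].  The argument is insensitive to replacing [s], [t], [u], [x], [y] by
    their [2 ^ n]-th powers. *)
Lemma colon_trace n (r : R) :
  (exists b c, r * u ^+ (2 ^ n) = s ^+ (2 ^ n) * b + t ^+ (2 ^ n) * c) <->
  exists e, iota r = e + sigma e.
Proof.
set q := (2 ^ n)%N; set X := x ^+ q; set Y := y ^+ q.
have eun : iota (u ^+ q) = iota (s ^+ q) * X + iota (t ^+ q) * Y.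
  by rewrite !rmorphXn eu frobD !exprMn.
have exn : X + sigma X = iota (t ^+ q) by rewrite !rmorphXn -frobD ex.
have eyn : Y + sigma Y = iota (s ^+ q) by rewrite !rmorphXn -frobD ey.
split=> [[b [c e]]|[e er]].
  have [z [ez _]] : exists z, iota r * X - iota b = iota (t ^+ q) * z /\
      iota c - iota r * Y = iota (s ^+ q) * z.
    rewrite !rmorphXn; apply: (coprimerX cst); rewrite -!rmorphXn.
    apply/eqP; rewrite -subr_eq0; apply/eqP.
    transitivity (iota r * iota (u ^+ q) - iota (s ^+ q * b + t ^+ q * c)).
      by rewrite eun rmorphD !rmorphM; ring.
    by rewrite -rmorphM e subrr.
  exists z; have nT : iota (t ^+ q) != 0.
    apply: contra_neq (integral_exp_neq0 q invariants_integral nt).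
    exact: iota_eq0.
  apply: (regularI (integral_regular dS nT)) => /=.
  have e' := congr1 (fun w => w + sigma w) ez.
  rewrite /= rmorphB !rmorphM !sigma_iota in e'.
  rewrite -{1}exn; transitivity (iota r * X - iota b + (iota r * sigma X - iota b) + (iota b + iota b)).
    by ring.
  by rewrite e' addSS; ring.
have [b eb] : exists b, iota r * X + iota (t ^+ q) * e = iota b.
  apply: sigma_fix; rewrite rmorphD !rmorphM !sigma_iota; apply/eqP.
  rewrite -subr_eq0 -(addr0 (_ - _)) -(addSS (iota r * X + iota (t ^+ q) * e)); apply/eqP.
  transitivity (iota r * (X + sigma X) + iota (t ^+ q) * (e + sigma e)); first by ring.
  by rewrite exn -er mulrC addSS.
have [c ec] : exists c, iota r * Y + iota (s ^+ q) * e = iota c.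
  apply: sigma_fix; rewrite rmorphD !rmorphM !sigma_iota; apply/eqP.
  rewrite -subr_eq0 -(addr0 (_ - _)) -(addSS (iota r * Y + iota (s ^+ q) * e)); apply/eqP.
  transitivity (iota r * (Y + sigma Y) + iota (s ^+ q) * (e + sigma e)); first by ring.
  by rewrite eyn -er mulrC addSS.
exists b, c; apply: iota_inj; rewrite rmorphD !rmorphM eun -eb -ec.
rewrite -[LHS]addr0 -(addSS (iota (s ^+ q) * iota (t ^+ q) * e)); ring.
Qed.

(** The colon ideal [C = (s, t) : u] of the perfection is the union of the traces
    at all levels.  It is closed under square roots, hence [C = C ^ 2], while
    [C] is neither [0] nor the unit ideal; by Nakayama's lemma it cannot be
    finitely generated. *)
Lemma invariants_perfection_not_coherent : ~ coherent Rperf.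
Proof.
move=> /(coherent_colon (inc 0 s) (inc 0 t) (inc 0 u)).
set C := [set r | _] => fgC.
have lvl n w : inc 0 w = inc n (w ^+ (2 ^ n)).
  by rewrite -(iter_frobenius hp) -[in RHS](add0n n) to_colim_shift.
have CE v : C v <-> exists n r, v = inc n r /\ exists e, iota r = e + sigma e.
  split=> [[b [c e]]|[n [r [-> /(colon_trace n) [b [c e]]]]]].
    have [n [r [b' [c' [hv hb hc]]]]] := colim_level3 v b c.
    exists n, r; split=> //; apply/(colon_trace n); exists b', c'.
    apply: (to_colim_inj (hp := hp) invariants_integral (n := n)).
    by rewrite to_perfD !to_perfM -!lvl -hb -hc -hv.
  by exists (inc n b), (inc n c); rewrite !(lvl n) -!to_perfM e to_perfD.
have sqrtC v : C v -> exists2 w, C w & v = w * w.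
  move=> /CE[n [r [-> tr]]]; exists (inc n.+1 r); first by apply/CE; exists n.+1, r.
  by rewrite -to_perfM -expr2 -(pFrobenius_autE hp) to_colim_phi.
have iC : is_ideal C.
  split=> [|v w [b [c e]] [b' [c' e']]|a v [b [c e]]].
  - by exists 0, 0; rewrite !mulr0 mul0r addr0.
  - by exists (b + b'), (c + c'); rewrite mulrDl e e'; ring.
  - by exists (a * b), (a * c); rewrite -mulrA e; ring.
have i0 : is_ideal [set 0 : Rperf].
  by split=> [|a b /= -> ->|a b /= ->] //=; rewrite ?addr0 ?mulr0.
have [v Cv|c Cc cP] := nakayama i0 iC iC fgC.
  have [w Cw ->] := sqrtC v Cv.
  by exists 0, w, w; split; rewrite ?add0r.
have Ct : C (inc 0 t).
  by apply/CE; exists 0%N, t; split=> //; exists x; rewrite ex.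
have := cP _ Ct; move=> /= /(perfection_integral (hp := hp) invariants_integral).
case/orP => /eqP.
  move/subr0_eq => c1; move: Cc; rewrite -c1 => /CE[n [r [e [w er]]]].
  apply: (@trace_neq1 w); rewrite -er -(rmorph1 iota); congr (iota _).
  apply: (to_colim_inj (hp := hp) invariants_integral (n := n)).
  by rewrite -e rmorph1.
by rewrite -[X in _ = X](rmorph0 (inc 0)) => /(to_colim_inj invariants_integral)/eqP; rewrite (negbTE nt).
Qed.

End Trace.
End Involution.

(** * The extension of Artin *)

Lemma artin_root (C : comNzRingType) (s t x y : C) : 2%N \in [pchar C] ->
    x * x = t * x + s -> y * y = s * y + t ->
  (s * x + t * y) * (s * x + t * y) = s * t * (s * x + t * y) + (s ^+ 3 + t ^+ 3).
Proof.
move=> pC ex ey.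
transitivity (s ^+ 2 * (x * x) + t ^+ 2 * (y * y) + (s * x * t * y) *+ 2); first by ring.
by rewrite mulrn_pchar // ex ey; ring.
Qed.

(** Over a ring [A] of characteristic two, [S = A[x, y]] with [x^2 = t x + s] and
    [y^2 = s y + t]; an element [((c0, c1), (c2, c3))] of [S] stands for
    [c0 + c1 x + c2 y + c3 x y].  The subring [R = A[u]] is generated by
    [u = s x + t y]. *)
Section ArtinExtension.
Context (A : comNzRingType) (s t : A).
Hypotheses (pA : 2%N \in [pchar A]) (rs : regular s) (rt : regular t).
Hypothesis cst : coprimer s t.

Local Notation T := (quad t s).
Local Notation iT := (qdC t s).
Local Notation S := (quad (iT s) (iT t)).
Local Notation iS := (qdC (iT s) (iT t)).
Local Notation R := (quad (s * t) (s ^+ 3 + t ^+ 3)).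
Local Notation x := (iS (qdZ t s)).
Local Notation y := (qdZ (iT s) (iT t)).

Definition art_incl : A -> S := iS \o iT.
HB.instance Definition _ := GRing.RMorphism.on art_incl.

Let addff (f : A) : f + f = 0.
Proof. by rewrite -mulr2n (mulrn_pchar pA). Qed.

Let oppff (f : A) : - f = f.
Proof. by apply/eqP; rewrite eq_sym -subr_eq0 opprK addff. Qed.

Lemma art_inclM c (p : S) : art_incl c * p =
  ((c * p.1.1, c * p.1.2), (c * p.2.1, c * p.2.2)).
Proof. by rewrite qdCM !qdCM. Qed.

Fact art_root : let z := art_incl s * x + art_incl t * y in
  z * z = art_incl (s * t) * z + art_incl (s ^+ 3 + t ^+ 3).
Proof.
have pS := rmorph_pchar art_incl pA.
have ex : x * x = art_incl t * x + art_incl s := qd_morphZ2 iS.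
have ey : y * y = art_incl s * y + art_incl t := qdZ2 (iT s) (iT t).
move=> z; rewrite /z (artin_root pS ex ey) (rmorphM art_incl) (rmorphD art_incl).
by rewrite !(rmorphXn art_incl).
Qed.

Definition art_iota : R -> S := qd_lift art_root.
HB.instance Definition _ := GRing.RMorphism.on art_iota.

Lemma art_iotaE p : art_iota p = ((p.1, p.2 * s), (p.2 * t, 0)).
Proof.
rewrite /art_iota qd_liftE mulrDr !art_inclM !qdDE /=.
by congr pair; congr pair; rewrite /=; ring.
Qed.

Lemma art_iota_inj : injective art_iota.
Proof.
move=> [f g] [f' g']; rewrite !art_iotaE /= => -[-> e _]; congr pair.
by apply: (regularI rs); rewrite /= mulrC e mulrC.
Qed.

Lemma art_iotaC c : art_iota (qdC _ _ c) = art_incl c.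
Proof. by rewrite /art_iota qd_liftE /= rmorph0 mul0r addr0. Qed.

Lemma art_iotaZ : art_iota (qdZ _ _) =
  art_iota (qdC _ _ s) * x + art_iota (qdC _ _ t) * y.
Proof. by rewrite !art_iotaC /art_iota qd_liftE rmorph0 rmorph1 add0r mul1r. Qed.

Let sigmaT := qd_conj (a := t) (b := s) (tau := idfun) erefl erefl.

Fact art_sigmaT_s : sigmaT (iT s) = iT s. Proof. exact: qd_conjC. Qed.
Fact art_sigmaT_t : sigmaT (iT t) = iT t. Proof. exact: qd_conjC. Qed.

(** The involution [x |-> x + t], [y |-> y + s]. *)
Definition art_sigma : S -> S := qd_conj art_sigmaT_s art_sigmaT_t.
HB.instance Definition _ := GRing.RMorphism.on art_sigma.

Lemma art_sigmaE p : art_sigma p =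
  ((p.1.1 + t * p.1.2 + s * (p.2.1 + t * p.2.2), p.1.2 + s * p.2.2),
   (p.2.1 + t * p.2.2, p.2.2)).
Proof.
rewrite /art_sigma qd_conjE /= /sigmaT !qd_conjE qdCM qdDE qdNE /= !oppff.
by congr pair; congr pair; rewrite ?mulrN ?oppff.
Qed.

Lemma art_sigmaK : involutive art_sigma.
Proof. by apply/qd_conjK/qd_conjK. Qed.

Lemma art_sigma_iota r : art_sigma (art_iota r) = art_iota r.
Proof.
rewrite art_sigmaE !art_iotaE /= !mulr0 !addr0; congr pair; congr pair.
rewrite -addrA [X in _ + X](_ : _ = s * t * r.2 + s * t * r.2); last by ring.
by rewrite addff addr0.
Qed.

(** An invariant [c0 + c1 x + c2 y + c3 x y] has [t c3 = 0] and
    [t c1 + s c2 = 0]; as [s] and [t] are coprime, it lies in [A + A u]. *)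
Lemma art_sigma_fix z : art_sigma z = z -> exists r, z = art_iota r.
Proof.
case: z => [[c0 c1] [c2 c3]]; rewrite art_sigmaE /= => -[e0 _ e2].
have c30 : c3 = 0.
  by apply: rt; rewrite -[LHS](addKr c2) e2 addNr.
have [|v [ev ew]] := cst (z := c2) (w := c1).
  apply/eqP; rewrite -subr_eq0 oppff; apply/eqP.
  move: e0; rewrite c30 mulr0 addr0 -addrA => /(congr1 (+%R (- c0))).
  by rewrite addKr addNr addrC.
by exists (c0, v); rewrite art_iotaE /= ev ew c30 [s * v]mulrC [t * v]mulrC.
Qed.

Lemma art_trace_x : x + art_sigma x = art_iota (qdC _ _ t).
Proof.
rewrite art_sigmaE art_iotaE !qdDE /= !(mulr0, mul0r, addr0, add0r, mulr1).
by rewrite addff.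
Qed.

Lemma art_trace_y : y + art_sigma y = art_iota (qdC _ _ s).
Proof.
rewrite art_sigmaE art_iotaE !qdDE /= !(mulr0, mul0r, addr0, add0r, mulr1).
by rewrite addff.
Qed.

(** The involution acts trivially modulo [(s, t)], so in characteristic two
    traces vanish there. *)
Lemma art_trace_neq1 (K : comNzRingType) (eps : {rmorphism A -> K}) :
  eps s = 0 -> eps t = 0 -> forall e : S, e + art_sigma e <> 1.
Proof.
move=> s0 t0 e /(congr1 (fun p : S => eps p.1.1)); rewrite art_sigmaE qdDE /=.
rewrite !rmorphD !rmorphM s0 t0 !mul0r !addr0 -rmorphD addff rmorph0 rmorph1.
by move/esym/eqP; rewrite oner_eq0.
Qed.

Lemma artin_invariants (K : comNzRingType) (eps : {rmorphism A -> K})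
    (hp : 2%N \in [pchar R]) : eps s = 0 -> eps t = 0 ->
    GRing.integral_domain_axiom S -> has_gcds S ->
  [/\ GRing.integral_domain_axiom R, integrally_closed R,
      gcd_domain (perfection hp) & ~ coherent (perfection hp)].
Proof.
move=> s0 t0 dS gS; have inj := art_iota_inj; have fix_ := art_sigma_fix.
have sK := art_sigmaK; have fi := art_sigma_iota.
split.
- exact: invariants_integral dS inj.
- apply: (invariants_integrally_closed dS inj fi fix_).
  exact: gcds_integrally_closed.
- exact: (invariants_perfection_gcd hp dS inj sK fi fix_ gS).
- apply: (invariants_perfection_not_coherent (hp := hp) dS inj fi fix_
    art_iotaZ art_trace_x art_trace_y).
  + by rewrite /= !art_iotaC; apply/qdC_coprimer/qdC_coprimer.
  + apply/eqP => -[t00]; have /eqP[] := oner_neq0 A.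
    by apply: rt; rewrite t00 mul0r.
  + exact: art_trace_neq1 s0 t0.
Qed.

End ArtinExtension.

(** * The example *)

Section Example.

Local Notation k := ('F_2 : fieldType).
Local Notation B := (psr k).
Local Notation A := (psr B).
Local Notation vs := (psX B).
Local Notation vt := (psC (psX k)).
Local Notation T := (quad vt vs).
Local Notation S := (quad (qdC vt vs vs) (qdC vt vs vt)).
Local Notation R := (quad (vs * vt) (vs ^+ 3 + vt ^+ 3)).
Local Notation epsB := ((idfun : {rmorphism k -> k}) \o @coef0 k).
Local Notation epsA := (epsB \o @coef0 B).

Lemma B_dvr : GRing.integral_domain_axiom B /\
  forall I : set B, is_ideal I -> principal_ideal I.
Proof.
apply: (@uniformizer_pid _ (psX k)); first exact: psX_regular.
  move=> f; have [f0|nf0] := eqVneq (f 0%N) 0; last first.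
    by left; apply: (ps_local_aug (@id_local_aug k)).
  by right; exists (ps_tail f); apply: psX_dvd.
move=> f fP; apply/funext => n; rewrite ps0; have [g eg] := fP n.+1.
exact: psXn_dvd eg _.
Qed.

Lemma B_noetherian : noetherian B.
Proof. by move=> I /B_dvr.2 /principal_fin_generated; apply. Qed.

Local Notation D := (quad (0 : B) (psX k)).

(** The ring [F_2[[t]][y]] with [y^2 = t] has uniformizer [y]. *)
Lemma D_dvr : GRing.integral_domain_axiom D /\
  forall I : set D, is_ideal I -> principal_ideal I.
Proof.
have h : 0 * 0 = epsB 0 * 0 + epsB (psX k) by rewrite !mulr0 add0r.
have loc : local_aug (qd_lift h).
  by apply: qd_local_aug; [apply/ps_local_aug/id_local_aug | rewrite rmorph0].
have rz : regular (qdZ (0 : B) (psX k)) by apply/qdZ_regular/psX_regular.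
apply: (uniformizer_pid rz).
  move=> p; have [f0|nf0] := eqVneq (qd_lift h p) 0; last first.
    by left; apply: loc.
  right; exists (p.2, ps_tail p.1); rewrite qdZM /= mul0r addr0 -psX_dvd.
    by case: p {f0}.
  by move: f0; rewrite qd_liftE mulr0 addr0.
apply: krull_intersection => //; first exact/qd_noetherian/B_noetherian.
by apply: (local_aug_jacobson loc); rewrite /= qd_liftE mulr0 addr0 rmorph0.
Qed.

Lemma A_noetherian : noetherian A.
Proof. exact/ps_noetherian/B_dvr.2. Qed.

Lemma A_local_aug : local_aug epsA.
Proof. exact/ps_local_aug/ps_local_aug/id_local_aug. Qed.

Lemma vs_regular : regular vs. Proof. exact: psX_regular. Qed.
Lemma vt_regular : regular vt. Proof. exact/psC_regular/psX_regular. Qed.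

Lemma vs_vt_coprimer : coprimer vs vt.
Proof.
move=> z w e; have w0 : w 0%N = 0.
  apply: (@psX_regular k); have := congr1 (@coef0 B) e.
  by rewrite !rmorphM /coef0 /= mul0r.
have ew := psX_dvd w0; exists (ps_tail w); split=> //.
by apply: (regularI vs_regular); rewrite /= e {1}ew mulrCA.
Qed.

Fact epsA_vs : epsA vs = 0. Proof. by []. Qed.
Fact epsA_vt : epsA vt = 0. Proof. by []. Qed.

Fact epsT_root : 0 * 0 = epsA vt * 0 + epsA vs.
Proof. by rewrite epsA_vs !mulr0 addr0. Qed.
Local Notation epsT := (qd_lift epsT_root).

Fact epsS_root : 0 * 0 = epsT (qdC vt vs vs) * 0 + epsT (qdC vt vs vt).
Proof. by rewrite !qd_liftE /= !mulr0 !addr0. Qed.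
Local Notation epsS := (qd_lift epsS_root).

Lemma epsSE p : epsS p = epsA p.1.1.
Proof. by rewrite qd_liftE mulr0 addr0 /= qd_liftE mulr0 addr0. Qed.

Lemma S_local_aug : local_aug epsS.
Proof.
apply: qd_local_aug; last by rewrite /= qd_liftE mulr0 addr0.
by apply: qd_local_aug; [exact: A_local_aug | exact: epsA_vt].
Qed.

Local Notation coefD := (qdC (0 : B) (psX k) \o @coef0 B).

Fact rhoT_root : 0 * 0 = coefD vt * 0 + coefD vs.
Proof. by rewrite !mulr0 add0r. Qed.
Local Notation rhoT := (qd_lift rhoT_root).

Lemma rhoTE p : rhoT p = qdC 0 (psX k) (p.1 0%N).
Proof. by rewrite qd_liftE mulr0 addr0. Qed.

Fact rhoS_root : let z := qdZ (0 : B) (psX k) in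
  z * z = rhoT (qdC vt vs vs) * z + rhoT (qdC vt vs vt).
Proof. by rewrite /= !rhoTE qdZ2. Qed.
(** Reduction modulo [x]: as [s = x^2 + t x] is sent to [0], the quotient [S / x]
    is [F_2[[t]][y]] with [y^2 = t], that is [F_2[[y]]]. *)
Local Notation rho := (qd_lift rhoS_root).

Lemma rhoE p : rho p = (p.1.1 0%N, p.2.1 0%N).
Proof. by rewrite qd_liftE /= !rhoTE [RHS]qd_split. Qed.

Local Notation vx := (qdC (qdC vt vs vs) (qdC vt vs vt) (qdZ vt vs)).

Lemma S_noetherian : noetherian S.
Proof. exact/qd_noetherian/qd_noetherian/A_noetherian. Qed.

(** In [T = A[x]] the element [s] is a multiple of [x], so the multiples of [x]
    are the [f + g x] with [f] divisible by [s]. *)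
Lemma rho_ker c : rho c = 0 <-> exists e, c = vx * e.
Proof.
have Zdvd (q : T) : q.1 0%N = 0 -> exists q', q = qdZ vt vs * q'.
  move=> q0; exists (q.2 - vt * ps_tail q.1, ps_tail q.1).
  by rewrite qdZM /= subrK -psX_dvd //; case: q {q0}.
rewrite rhoE; split=> [[/Zdvd[e1 e] /Zdvd[e2 e']]|[e ->]].
  by exists (e1, e2); rewrite qdCM -e -e'; case: c {e e'}.
by rewrite qdCM !qdZM /= !psXME.
Qed.

Lemma S_gcds : GRing.integral_domain_axiom S /\ has_gcds S.
Proof.
apply: (@gcds_of_quotient S D rho vx).
- exact: S_noetherian.
- exact/qdC_regular/qdZ_regular/vs_regular.
- apply: (local_aug_jacobson S_local_aug); exact: epsSE.
- by move=> [d0 d1]; exists ((psC d0, 0), (psC d1, 0)); exact: rhoE.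
- exact: rho_ker.
- exact: D_dvr.1.
- exact: D_dvr.2.
Qed.

Lemma pchar_A : 2%N \in [pchar A].
Proof. exact/(rmorph_pchar (@psC B))/(rmorph_pchar (@psC k))/pchar_Fp. Qed.

Lemma pchar_R : 2%N \in [pchar R].
Proof. exact: (rmorph_pchar (qdC (vs * vt) (vs ^+ 3 + vt ^+ 3)) pchar_A). Qed.

Lemma R_complete_local : complete_local R.
Proof.
have ovs := @order_geX k; have ovt := @order_geC k.
apply: quad_complete_local; first exact: (order_ge_le _ (order_geM ovs ovt)).
apply: order_geD.
  exact: (order_ge_le _ (order_geM ovs (order_geM ovs ovs))).
exact: (order_ge_le _ (order_geM ovt (order_geM ovt ovt))).
Qed.

Lemma perfection_example : exists (R : idomainType) (hp : 2%N \in [pchar R]),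
  [/\ noetherian R, complete_local R, normal_domain R,
      gcd_domain (perfection hp) & ~ coherent (perfection hp)].
Proof.
have [dS gS] := S_gcds.
have [dR cR gR ncR] := artin_invariants pchar_A vs_regular vt_regular
  vs_vt_coprimer pchar_R epsA_vs epsA_vt dS gS.
apply: (idomain_witness dR _ R_complete_local cR gR ncR).
exact/qd_noetherian/A_noetherian.
Qed.

End Example.

Theorem theorem1p1 :
  exists p : nat, prime p /\
  exists (R : idomainType) (hp : p \in [pchar R]%R),
    [/\ noetherian R, complete_local R, normal_domain R,
        gcd_domain (perfection hp) & ~ coherent (perfection hp)].
Proof. by exists 2%N; split=> //; apply: perfection_example. Qed.
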